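(* Let $q\in\{3,5,7,9\}$. Then every non-associative $4$-dimensional symplectic semifield over $\mathbb{F}_q$ is Knuth-equivalent to a Dickson commutative semifield (of dimension $4$ over $\mathbb{F}_q$, i.e. with $k=2$ in the definition below).
   Context: A (pre)semifield $\mathbb{S}$ of dimension $n$ over $\mathbb{F}_q$ is an $n$-dimensional $\mathbb{F}_q$-vector space with an $\mathbb{F}_q$-bilinear multiplication $*$ without zero divisors; associativity and an identity are not assumed, and $\mathbb{F}_q$ is contained in the centre. Two semifields $(\mathbb{S},* )$, $(\mathbb{S}',*')$ are isotopic if there are invertible $\mathbb{F}_q$-linear maps $F,G,H$ with $F(x)*'G(y)=H(x*y)$ for all $x,y$. Each isotopism class gives rise (via Knuth's cubical array operations, i.e. permuting the three indices of the structure tensor of the multiplication, which include transposition and dualisation) to at most six isotopism classes, the Knuth orbit; semifields whose isotopism classes lie in the same Knuth orbit are Knuth-equivalent. $\mathbb{S}$ defines a spread of $\mathbb{S}\oplus\mathbb{S}$ with elements $\{(x,x*y):x\in\mathbb{S}\}$, $y\in\mathbb{S}$, and $\{(0,y)\}$; $\mathbb{S}$ is symplectic if some non-degenerate alternating form on $\mathbb{S}\oplus\mathbb{S}$ makes all spread elements totally isotropic. For $q$ odd, a Dickson commutative semifield is $\mathbb{F}_{q^k}\times\mathbb{F}_{q^k}$ with multiplication $(x,y)\circ(u,v)=(xu+\eta(yv)^\sigma,\,xv+yu)$, where $\sigma\in\mathrm{Gal}(\mathbb{F}_{q^k}/\mathbb{F}_q)$ and $\eta\in\mathbb{F}_{q^k}$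 is a non-square. *)

(* Defs.v *)
From HB Require Import structures.
From mathcomp Require Import all_boot all_order all_algebra all_fingroup all_field.
From mathcomp Require Import sesquilinear.

Set Implicit Arguments.
Unset Strict Implicit.
Unset Printing Implicit Defensive.

Import GRing.Theory.
Local Open Scope ring_scope.

(* The multiplication of a (pre)semifield over F is a bundled bilinear map on a
   vectType, subject to [no_zero_divisors]; neither an identity nor
   associativity is required. *)

Definition no_zero_divisors (F : fieldType) (S : vectType F)
    (mul : S -> S -> S) : Prop :=
  forall x y : S, mul x y = 0 -> x = 0 \/ y = 0.

Definition isotopic (F : fieldType) (S S' : vectType F)
    (mul : S -> S -> S) (mul' : S' -> S' -> S') : Prop :=
  exists f g h : {linear S -> S'},
    [/\ bijective f, bijective g, bijective h &
        forall x y : S, mul' (f x) (g y) = h (mul x y)].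

Section KnuthOrbit.

Variable F : fieldType.

(* Structure constants: e_i * e_j = \sum_k (cubical_array mul e i j k) e_k. *)
Definition cubical_array (S : vectType F) (mul : S -> S -> S)
    (e : (\dim {:S}).-tuple S) (i j k : 'I_(\dim {:S})) : F :=
  coord e k (mul (tnth e i) (tnth e j)).

Definition permute_array (n : nat) (s : 'S_3) (T : 'I_n -> 'I_n -> 'I_n -> F)
    (i j k : 'I_n) : F :=
  let v := tnth [tuple i; j; k] in T (v (s 0)) (v (s 1)) (v (s 2)).

Definition mul_of_array (n : nat) (T : 'I_n -> 'I_n -> 'I_n -> F)
    (x y : 'rV[F]_n) : 'rV[F]_n :=
  \row_k \sum_i \sum_j x 0 i * y 0 j * T i j k.

(* [mul'] lies in an isotopism class obtained from that of [mul] by one of the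
   six permutations of the indices. The isotopism class of the permuted array
   does not depend on the basis e, which is why e is merely asked to exist. *)
Definition knuth_equivalent (S S' : vectType F)
    (mul : S -> S -> S) (mul' : S' -> S' -> S') : Prop :=
  exists (e : (\dim {:S}).-tuple S) (s : 'S_3),
    basis_of fullv e /\
    isotopic (mul_of_array (permute_array s (cubical_array mul e))) mul'.

End KnuthOrbit.

Section Symplectic.

Variables (F : fieldType) (S : vectType F) (mul : S -> S -> S).

Definition spread_elt (y : S) : pred (S * S) := [pred p | p.2 == mul p.1 y].

Definition spread_infty : pred (S * S) := [pred p | p.1 == 0].

Definition totally_isotropic (B : S * S -> S * S -> F) (W : pred (S * S)) :
    Prop :=
  {in W &, forall u v, B u v = 0}.

(* Alternating forms are skew-symmetric, so taking B in {skew_symmetric _}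
   (for which the library defines [nondegenerate]) loses no form; the converse
   inclusion fails in characteristic 2, hence the condition B u u = 0. *)
Definition symplectic : Prop :=
  exists B : {skew_symmetric (S * S)%type},
    [/\ nondegenerate B, forall u, B u u = 0,
        forall y, totally_isotropic B (spread_elt y) &
        totally_isotropic B spread_infty].

End Symplectic.

Definition dickson_mul (F : fieldType) (L : splittingFieldType F)
    (sigma : gal_of {:L}) (eta : L) (a b : L * L) : L * L :=
  (a.1 * b.1 + eta * sigma (a.2 * b.2), a.1 * b.2 + a.2 * b.1).

(* Main.v *)
(* Permuting the last two indices of the structure tensor and twisting by the
   symplectic form turns the multiplication into a commutative product c on
   V = F^4 without zero divisors, so that the symmetric forms
   (u, v) |-> <z, c u v>, z <> 0, are all nondegenerate. Let lam be a nonsquare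
   of F, i^2 = lam, L = F(i), and write ^ for conjugation and Tr for the trace
   of L over F.

   Counting zeros of the quadratic form of a z that vanishes on a 2-dimensional
   subspace gives nonzero x, y with c y y = lam (c x x). The forms vanishing on
   <x, y> make up a plane, and V gets coordinates (X, Y) in L^2 in which this
   plane consists of the forms Tr (th (X Y' + X' Y + kap (Y Y')^)), th in L,
   with kap = 0 or 1. An arbitrary form is Tr (al X X' + th (X Y' + X' Y) +
   ga Y Y') plus hermitian terms, and a finite search in L, where q <= 9 enters,
   shows that nondegeneracy of the whole space kills the hermitian terms. Hence
   ga = m al + n al^ + kap th^, and al ga - th^2 is never 0. If kap = 1, this
   forces n^^2 - m to be a square, and a linear change of (X, Y) leads to
   kap = 0; if kap = 0, it forces m = 0 or n = 0. In either case the product is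
   (X X' + eta (Y Y')^sigma, X Y' + X' Y) with eta a nonsquare. *)

Require Import Defs.
From HB Require Import structures.
From mathcomp Require Import all_boot all_order all_algebra all_fingroup all_field.
From mathcomp Require Import sesquilinear ring.

Set Implicit Arguments.
Unset Strict Implicit.
Unset Printing Implicit Defensive.

Import GRing.Theory.
Local Open Scope ring_scope.

(** * Finite search over the quadratic extension *)

(** The relation c y y = lam (c x x) turns the three conditions for <x, y> to be totally isotropic
    into two, so that a plane of forms satisfies them and not just a line. A nonzero form of that
    plane pairs <x, y> perfectly with V / <x, y>; comparing two such pairings gives an operator
    without eigenvalues in F, and this operator becomes multiplication by i. The gain of working
    over L: a form without hermitian terms is the trace of an L-bilinear form, so its Gram
    determinant is the norm of al ga - th^2, and nondegeneracy becomes a statement about squares in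
    L. With hermitian terms this factorization is lost, and that part is left to the search. Its
    unknowns are two forms complementary to the plane. To keep it short, the first form is scaled to
    few values of al, each form is sieved alone against all th, and only survivors are paired. *)

(* Digits name the elements of F, and c_ab names a + b i in L = F(i). Plain
   enumerations make every table lookup a single match, on which the feasibility
   of the search depends. *)
Inductive digit := d0 | d1 | d2 | d3 | d4 | d5 | d6 | d7 | d8.

Inductive code :=
  c00 | c01 | c02 | c03 | c04 | c05 | c06 | c07 | c08 | c10 | c11 | c12 |
  c13 | c14 | c15 | c16 | c17 | c18 | c20 | c21 | c22 | c23 | c24 | c25 |
  c26 | c27 | c28 | c30 | c31 | c32 | c33 | c34 | c35 | c36 | c37 | c38 |
  c40 | c41 | c42 | c43 | c44 | c45 | c46 | c47 | c48 | c50 | c51 | c52 |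
  c53 | c54 | c55 | c56 | c57 | c58 | c60 | c61 | c62 | c63 | c64 | c65 |
  c66 | c67 | c68 | c70 | c71 | c72 | c73 | c74 | c75 | c76 | c77 | c78 |
  c80 | c81 | c82 | c83 | c84 | c85 | c86 | c87 | c88.

Definition tab_digit A (f : digit -> A) x :=
  match x with
  d0 => f d0 | d1 => f d1 | d2 => f d2 | d3 => f d3 | d4 => f d4 |
  d5 => f d5 | d6 => f d6 | d7 => f d7 | d8 => f d8
  end.

Definition tab_code A (f : digit -> digit -> A) x :=
  match x with
  c00 => f d0 d0 | c01 => f d0 d1 | c02 => f d0 d2 | c03 => f d0 d3 |
  c04 => f d0 d4 | c05 => f d0 d5 | c06 => f d0 d6 | c07 => f d0 d7 |
  c08 => f d0 d8 | c10 => f d1 d0 | c11 => f d1 d1 | c12 => f d1 d2 |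
  c13 => f d1 d3 | c14 => f d1 d4 | c15 => f d1 d5 | c16 => f d1 d6 |
  c17 => f d1 d7 | c18 => f d1 d8 | c20 => f d2 d0 | c21 => f d2 d1 |
  c22 => f d2 d2 | c23 => f d2 d3 | c24 => f d2 d4 | c25 => f d2 d5 |
  c26 => f d2 d6 | c27 => f d2 d7 | c28 => f d2 d8 | c30 => f d3 d0 |
  c31 => f d3 d1 | c32 => f d3 d2 | c33 => f d3 d3 | c34 => f d3 d4 |
  c35 => f d3 d5 | c36 => f d3 d6 | c37 => f d3 d7 | c38 => f d3 d8 |
  c40 => f d4 d0 | c41 => f d4 d1 | c42 => f d4 d2 | c43 => f d4 d3 |
  c44 => f d4 d4 | c45 => f d4 d5 | c46 => f d4 d6 | c47 => f d4 d7 |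
  c48 => f d4 d8 | c50 => f d5 d0 | c51 => f d5 d1 | c52 => f d5 d2 |
  c53 => f d5 d3 | c54 => f d5 d4 | c55 => f d5 d5 | c56 => f d5 d6 |
  c57 => f d5 d7 | c58 => f d5 d8 | c60 => f d6 d0 | c61 => f d6 d1 |
  c62 => f d6 d2 | c63 => f d6 d3 | c64 => f d6 d4 | c65 => f d6 d5 |
  c66 => f d6 d6 | c67 => f d6 d7 | c68 => f d6 d8 | c70 => f d7 d0 |
  c71 => f d7 d1 | c72 => f d7 d2 | c73 => f d7 d3 | c74 => f d7 d4 |
  c75 => f d7 d5 | c76 => f d7 d6 | c77 => f d7 d7 | c78 => f d7 d8 |
  c80 => f d8 d0 | c81 => f d8 d1 | c82 => f d8 d2 | c83 => f d8 d3 |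
  c84 => f d8 d4 | c85 => f d8 d5 | c86 => f d8 d6 | c87 => f d8 d7 |
  c88 => f d8 d8
  end.

Definition mk_code a b :=
  match a, b with
  d0, d0 => c00 | d0, d1 => c01 | d0, d2 => c02 | d0, d3 => c03 |
  d0, d4 => c04 | d0, d5 => c05 | d0, d6 => c06 | d0, d7 => c07 |
  d0, d8 => c08 | d1, d0 => c10 | d1, d1 => c11 | d1, d2 => c12 |
  d1, d3 => c13 | d1, d4 => c14 | d1, d5 => c15 | d1, d6 => c16 |
  d1, d7 => c17 | d1, d8 => c18 | d2, d0 => c20 | d2, d1 => c21 |
  d2, d2 => c22 | d2, d3 => c23 | d2, d4 => c24 | d2, d5 => c25 |
  d2, d6 => c26 | d2, d7 => c27 | d2, d8 => c28 | d3, d0 => c30 |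
  d3, d1 => c31 | d3, d2 => c32 | d3, d3 => c33 | d3, d4 => c34 |
  d3, d5 => c35 | d3, d6 => c36 | d3, d7 => c37 | d3, d8 => c38 |
  d4, d0 => c40 | d4, d1 => c41 | d4, d2 => c42 | d4, d3 => c43 |
  d4, d4 => c44 | d4, d5 => c45 | d4, d6 => c46 | d4, d7 => c47 |
  d4, d8 => c48 | d5, d0 => c50 | d5, d1 => c51 | d5, d2 => c52 |
  d5, d3 => c53 | d5, d4 => c54 | d5, d5 => c55 | d5, d6 => c56 |
  d5, d7 => c57 | d5, d8 => c58 | d6, d0 => c60 | d6, d1 => c61 |
  d6, d2 => c62 | d6, d3 => c63 | d6, d4 => c64 | d6, d5 => c65 |
  d6, d6 => c66 | d6, d7 => c67 | d6, d8 => c68 | d7, d0 => c70 |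
  d7, d1 => c71 | d7, d2 => c72 | d7, d3 => c73 | d7, d4 => c74 |
  d7, d5 => c75 | d7, d6 => c76 | d7, d7 => c77 | d7, d8 => c78 |
  d8, d0 => c80 | d8, d1 => c81 | d8, d2 => c82 | d8, d3 => c83 |
  d8, d4 => c84 | d8, d5 => c85 | d8, d6 => c86 | d8, d7 => c87 |
  d8, d8 => c88
  end.

Definition digits : seq digit := [:: d0; d1; d2; d3; d4; d5; d6; d7; d8].

Definition val_digit x : nat :=
  match x with
  | d0 => 0 | d1 => 1 | d2 => 2 | d3 => 3 | d4 => 4
  | d5 => 5 | d6 => 6 | d7 => 7 | d8 => 8
  end.

Definition digit_of (n : nat) : digit := nth d0 digits n.

(* Strict evaluation must stop at the first decisive element, which the boolean
   connectives behind [has] and [all] would prevent. *)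
Fixpoint exb A (f : A -> bool) s :=
  if s is x :: s' then (if f x then true else exb f s') else false.

Fixpoint allb A (f : A -> bool) s :=
  if s is x :: s' then (if f x then allb f s' else false) else true.

Fixpoint filterb A (f : A -> bool) s :=
  if s is x :: s' then (if f x then x :: filterb f s' else filterb f s')
  else [::].

Record digit_field := DigitField {
  dig_list : seq digit;
  dig_add : digit -> digit -> digit;
  dig_mul : digit -> digit -> digit;
  dig_lam : digit
}.

Definition prime_digits p lam := DigitField (take p digits)
  (fun x y => digit_of ((val_digit x + val_digit y) %% p))
  (fun x y => digit_of ((val_digit x * val_digit y) %% p)) lam.

(* The digit a + 3 b stands for a + b j, where j^2 = -1. *)
Definition nine_digits :=
  let enc a b := digit_of (a %% 3 + 3 * (b %% 3)) in
  let a x := (val_digit x %% 3)%N in let b x := (val_digit x %/ 3)%N in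
  DigitField digits
    (fun x y => enc (a x + a y) (b x + b y))%N
    (fun x y => enc (a x * a y + 2 * (b x * b y)) (a x * b y + b x * a y))%N d4.

Definition tab_digit2 (f : digit -> digit -> digit) : digit -> digit -> digit :=
  tab_digit (fun x => tab_digit (f x)).

Definition tabulate_digits k := DigitField (dig_list k)
  (tab_digit2 (dig_add k)) (tab_digit2 (dig_mul k)) (dig_lam k).

Definition digits3 := Eval vm_compute in tabulate_digits (prime_digits 3 d2).
Definition digits5 := Eval vm_compute in tabulate_digits (prime_digits 5 d2).
Definition digits7 := Eval vm_compute in tabulate_digits (prime_digits 7 d3).
Definition digits9 := Eval vm_compute in tabulate_digits nine_digits.

Definition digits_for q :=
  match q with 3 => digits3 | 5 => digits5 | 7 => digits7 | _ => digits9 end.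

Record code_field := CodeField {
  ground : seq code;
  elements : seq code;
  cadd : code -> code -> code;
  cmul : code -> code -> code;
  copp : code -> code;
  cconj : code -> code;
  cis_square : code -> bool
}.

Definition is_c0 x := if x is c00 then true else false.

Section Quadratic.

Variable k : digit_field.
Let add := dig_add k.
Let mul := dig_mul k.

Definition re := tab_code (fun a _ => a).
Definition im := tab_code (fun _ b => b).

Definition dig_opp x := nth d0 (dig_list k)
  (find (fun y => if add x y is d0 then true else false) (dig_list k)).

Definition qadd x y := mk_code (add (re x) (re y)) (add (im x) (im y)).

Definition qmul x y :=
  mk_code (add (mul (re x) (re y)) (mul (dig_lam k) (mul (im x) (im y))))
          (add (mul (re x) (im y)) (mul (im x) (re y))).

Definition qopp x := mk_code (dig_opp (re x)) (dig_opp (im x)).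

Definition qconj x := mk_code (re x) (dig_opp (im x)).

Definition qelements := [seq mk_code a b | a <- dig_list k, b <- dig_list k].

Definition qis_square x := exb (fun y => is_c0 (qadd x (qopp (qmul y y)))) qelements.

Definition tab_code1 A (f : code -> A) : code -> A :=
  tab_code (fun a b => f (mk_code a b)).

Definition tabulate_codes := CodeField
  [seq mk_code a d0 | a <- dig_list k] qelements
  (tab_code1 (fun x => tab_code1 (qadd x)))
  (tab_code1 (fun x => tab_code1 (qmul x)))
  (tab_code1 qopp) (tab_code1 qconj) (tab_code1 qis_square).

End Quadratic.

Definition codes3 := Eval vm_compute in tabulate_codes digits3.
Definition codes5 := Eval vm_compute in tabulate_codes digits5.
Definition codes7 := Eval vm_compute in tabulate_codes digits7.
Definition codes9 := Eval vm_compute in tabulate_codes digits9.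

Definition codes_for q :=
  match q with 3 => codes3 | 5 => codes5 | 7 => codes7 | _ => codes9 end.

Section Search.

Variables (gr els : seq code) (add mul : code -> code -> code).
Variables (opp conj : code -> code).
Let sub x y := add x (opp y).
Let sq x := mul x x.
Let nrm x := mul x (conj x).
Let tr x := add x (conj x).
Let two := add c10 c10.
Let ci := c01.

(* As a polynomial in de, gram_det is P + de (l - c1 de) with
   P = c1 N(g) + n - Tr (g h); the entries n, h and l do not involve ga. *)
Definition sieve_row (al be ta th : code) : code * code * code * code :=
  let th' := conj th in
  (th', sq (sub (nrm th) (nrm ta)),
   sub (add (mul al (sq th')) (mul (conj al) (sq ta)))
       (mul two (mul be (mul ta th'))),
   sub (tr (mul two (mul (mul ta (conj al)) th)))
       (mul two (mul be (add (nrm th) (nrm ta))))).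

Variable kap : bool.

(** One row per th; a de survives if no row gives determinant zero. The test on [des] comes first so
    that the remaining th are skipped once no de is left. *)
Fixpoint sieve c1 ga rows des :=
  if des is [::] then [::] else
  if rows is (th', n, h, l) :: rows' then
    let g := if kap then add ga th' else ga in
    let P := sub (add (mul c1 (nrm g)) n) (tr (mul g h)) in
    sieve c1 ga rows'
      (filterb (fun de => if is_c0 (add P (mul de (sub l (mul c1 de))))
                          then false else true) des)
  else des.

(* All (ta, ga, de) such that no th makes the Gram determinant vanish. *)
Definition net al be ta gas des : seq (code * code * code) :=
  let rows := [seq sieve_row al be ta th | th <- els] in
  let c1 := sub (nrm al) (sq be) in
  flatten [seq [seq (ta, ga, de) | de <- sieve c1 ga rows des] | ga <- gas].

Definition nets al be (tg : seq (code * seq code)) :=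
  flatten [seq net al be p.1 p.2 gr | p <- tg].

Definition all_tg : seq (code * seq code) :=
  [seq (ta, els) | ta <- els].

(* Modulo multiples of the first form and scaling, the second one has
   al4 in F i al and be4 in {0, 1}; when be4 = 1, a member of the pencil with
   N(al) = be^2 would be degenerate for a suitable th. *)
Definition complements al : seq (code * code) :=
  (mul ci al, c00) ::
  [seq (al4, c10) | al4 <- filterb (fun al4 =>
       allb (fun s => if is_c0 (sub (nrm (add al4 (mul s al))) c10)
                      then false else true) gr)
     [seq mul t (mul ci al) | t <- gr]].

(** Up to scalars, the combinations of the two forms are each form alone, already sieved, and z
    times the first plus the second with z nonzero, whence [behead]. An empty [net] means that some
    th makes the combination degenerate. *)
Definition excluded al al4 be4 (x y : code * code * code) :=
  let: (ta3, ga3, de3) := x in let: (ta4, ga4, de4) := y in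
  exb (fun z =>
    if net (add (mul z al) al4) be4 (add (mul z ta3) ta4)
         [:: add (mul z ga3) ga4] [:: add (mul z de3) de4] is [::]
    then true else false) (behead gr).

Definition is_diagonal be4 (x y : code * code * code) :=
  let: (ta3, _, de3) := x in let: (ta4, _, de4) := y in
  if is_c0 be4 then if is_c0 ta3 then if is_c0 de3 then if is_c0 ta4 then
  is_c0 de4 else false else false else false else false.

Definition search reps tg3 :=
  allb (fun al =>
    let s3 := nets al c00 tg3 in
    allb (fun p =>
      let s4 := nets p.1 p.2 all_tg in
      allb (fun x => allb (fun y =>
        if is_diagonal p.2 x y then true else excluded al p.1 p.2 x y) s4) s3)
    (complements al)) reps.

End Search.

Definition search_codes k kap reps tg3 :=
  search (ground k) (elements k) (cadd k) (cmul k) (copp k) (cconj k)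
    kap reps tg3.

(* Without twist, rescaling Y makes ta equal to 1, or to 0 with ga in {0, 1, g}. *)
Definition tg_normal k g : seq (code * seq code) :=
  [:: (c10, elements k); (c00, [:: c00; c10; g])].

(** An element of L is a square exactly when its norm is a square in F. As N(i) = -lam, [c01] is a
    nonsquare when -1 is a square, that is for q = 5 and 9; for q = 3 and 7 the norm 1 - lam of 1 +
    i is a nonsquare. *)
Definition nonsquare_for q := if q is 3 then c11 else if q is 7 then c11 else c01.

(* With twist, X and Y cannot be rescaled independently, and for q = 5 this
   takes six representatives of al instead of two. *)
Definition twisted_reps_for q :=
  match q with
  | 5 => [:: c10; c01; c11; c21; c31; c41]
  | _ => [:: c10; nonsquare_for q]
  end.

Definition plain_search q := let g := nonsquare_for q in
  search_codes (codes_for q) false [:: c10; g] (tg_normal (codes_for q) g).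

Definition twisted_search q :=
  search_codes (codes_for q) true (twisted_reps_for q)
    (all_tg (elements (codes_for q))).

Lemma allbE A (f : A -> bool) s : allb f s = all f s.
Proof. by elim: s => //= x s ->; case: (f x). Qed.

Lemma exbE A (f : A -> bool) s : exb f s = has f s.
Proof. by elim: s => //= x s ->; case: (f x). Qed.

Lemma filterbE A (f : A -> bool) s : filterb f s = filter f s.
Proof. by elim: s => //= x s ->; case: (f x). Qed.

Lemma mk_codeK : cancel (fun x => (val_digit (re x), val_digit (im x)))
  (fun p => mk_code (digit_of p.1) (digit_of p.2)).
Proof. by case. Qed.

HB.instance Definition _ := Equality.copy code (can_type mk_codeK).

(** * Degenerate members and rescaling of forms on L^2 *)

Section GramDeterminant.

Variables (L : fieldType) (conj : {rmorphism L -> L}).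

Definition norm x := x * conj x.
Definition trace x := x + conj x.

(* The determinant of the matrix of bform below in X, X^, Y, Y^. *)
Definition gram_det al be th ta ga de :=
  (norm al - be ^+ 2) * (norm ga - de ^+ 2) + (norm th - norm ta) ^+ 2
  - trace (conj al * (th ^+ 2 * conj ga - 2 * de * th * ta + ta ^+ 2 * ga))
  + 2 * be * (trace (th * conj ta * conj ga) - de * (norm th + norm ta)).

(** Nondegeneracy of all nonzero forms in coordinates: r and s in F weight two complementary forms,
    and th in L gives the member of the pencil, which adds [conj th] to ga when there is a twist.
    The complementary forms have no th of their own, as the pencil absorbs it, and the first one has
    be = 0. *)
Definition nonsingular (kap : bool) al3 ta3 ga3 de3 al4 be4 ta4 ga4 de4 :=
  forall th r s, conj r = r -> conj s = s ->
    ~~ [&& th == 0, r == 0 & s == 0] ->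
  gram_det (r * al3 + s * al4) (s * be4) th (r * ta3 + s * ta4)
    (r * ga3 + s * ga4 + conj th *+ kap) (r * de3 + s * de4) != 0.

Hypothesis conjK : involutive conj.

(** The block of X, X^ has rank one with kernel spanned by (b, -a), and this value of th makes that
    vector orthogonal to Y and Y^ as well. Since g is arbitrary, a twist does no harm. *)
Lemma gram_det_degenerate a b t g d : conj b = b -> conj d = d -> b != 0 ->
  norm a = b ^+ 2 -> gram_det a b (conj t * a / b) t g d = 0.
Proof.
move=> cb cd b0; rewrite /norm => nab.
have a0 : a != 0.
  by apply: contraNneq b0 => a0; rewrite -sqrf_eq0 -nab a0 mul0r.
have ca : conj a = b ^+ 2 / a by rewrite -nab mulrAC divff ?mul1r.
rewrite /gram_det /norm /trace.
rewrite ?(rmorphD, rmorphB, rmorphM, rmorphN, rmorphXn, fmorphV, rmorph1) /=.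
by rewrite ?conjK ?cb ?cd ?ca; field; rewrite a0 b0.
Qed.

(** With al = be = 0 the determinant is (N(th) - N(ta))^2, so th = ta is fatal. *)
Lemma gram_det_null t g d : gram_det 0 0 t t g d = 0.
Proof. by rewrite /gram_det /norm /trace !(rmorph0, subrr); ring. Qed.

Lemma nonsingular_reduce kap al3 ta3 ga3 de3 al4 be4 ta4 ga4 de4 x y :
    conj x = x -> conj y = y -> y != 0 ->
    nonsingular kap al3 ta3 ga3 de3 al4 be4 ta4 ga4 de4 ->
  nonsingular kap al3 ta3 ga3 de3 (y * (al4 - x * al3)) (y * be4)
    (y * (ta4 - x * ta3)) (y * (ga4 - x * ga3)) (y * (de4 - x * de3)).
Proof.
move=> cx cy y0 ns th r s cr cs nz.
have := ns th (r - s * y * x) (s * y).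
rewrite !(rmorphM, rmorphB) /= cx cy cr cs => /(_ erefl erefl).
have -> : [&& th == 0, r - s * y * x == 0 & s * y == 0] = false.
  apply: contraNF nz => /and3P[-> r0]; rewrite mulf_eq0 (negbTE y0) orbF.
  by move=> /eqP s0; move: r0; rewrite s0 !mul0r subr0 eqxx andbT.
move=> /(_ isT).
by congr (_ != 0); congr gram_det; ring.
Qed.

Lemma gram_det_scale x y a b th t g d :
  gram_det (x ^+ 2 * a) (norm x * b) (x * y * th) (x * conj y * t)
    (y ^+ 2 * g) (norm y * d)
  = (norm x * norm y) ^+ 2 * gram_det a b th t g d.
Proof.
rewrite /gram_det /norm /trace.
by rewrite ?(rmorphD, rmorphB, rmorphM, rmorphN, rmorphXn) /= ?conjK; ring.
Qed.

(** Substituting x X and y Y multiplies th by x y and ga by y^2. With a twist, ga contains the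
    conjugate of th, which must scale in the same way: this is the condition under [kap]. The factor
    c only rescales the first form. *)
Lemma nonsingular_scale (kap : bool) al3 ta3 ga3 de3 al4 be4 ta4 ga4 de4
    (c x y : L) :
    conj c = c -> c != 0 -> x != 0 -> y != 0 ->
    (kap -> x * y = conj y ^+ 2) ->
    nonsingular kap al3 ta3 ga3 de3 al4 be4 ta4 ga4 de4 ->
  nonsingular kap (c * (al3 * x ^+ 2)) (c * (x * conj y * ta3))
    (c * (ga3 * y ^+ 2)) (c * (norm y * de3))
    (x ^+ 2 * al4) (norm x * be4) (x * conj y * ta4) (y ^+ 2 * ga4)
    (norm y * de4).
Proof.
move=> cc c0 x0 y0 xy ns th r s cr cs nz.
have := ns (th / (x * y)) (r * c) s _ cs; rewrite rmorphM /= cr cc => /(_ erefl).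
rewrite !mulf_eq0 invr_eq0 mulf_eq0 (negbTE x0) (negbTE y0) (negbTE c0) !orbF.
move=> /(_ nz); rewrite -(@mulrI_eq0 _ ((norm x * norm y) ^+ 2)); last first.
  by apply/lregP; rewrite expf_neq0 // !mulf_neq0 ?fmorph_eq0.
rewrite -gram_det_scale; congr (_ != 0); congr gram_det; try by ring.
  by rewrite mulrC divfK // mulf_neq0.
case: kap xy {ns} => [/(_ isT) xy|_]; rewrite ?mulr1n ?mulr0n; last by ring.
rewrite fmorph_div /= [in conj (x * y)]xy rmorphXn /= conjK.
by field; rewrite y0.
Qed.

End GramDeterminant.

(** * Soundness of the search *)

Section SearchSound.

Variables (L : fieldType) (conj : {rmorphism L -> L}).
Hypothesis conjK : involutive conj.

Variables (k : code_field) (phi : code -> L).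
Hypothesis phi0 : phi c00 = 0.
Hypothesis phi1 : phi c10 = 1.
Hypothesis phiD : {morph phi : x y / cadd k x y >-> x + y}.
Hypothesis phiM : {morph phi : x y / cmul k x y >-> x * y}.
Hypothesis phiN : {morph phi : x / copp k x >-> - x}.
Hypothesis phiC : forall x, phi (cconj k x) = conj (phi x).
Hypothesis ground_conj : forall x, x \in ground k -> conj (phi x) = phi x.
Hypothesis ground_surj :
  forall x, conj x = x -> exists2 c, c \in ground k & phi c = x.
Hypothesis elements_surj : forall x, exists2 c, c \in elements k & phi c = x.
Hypothesis ground_span : forall x, exists y z,
  [/\ conj y = y, conj z = z & x = y + z * phi c01].

Let knet := net (elements k) (cadd k) (cmul k) (copp k) (cconj k).
Let knets := nets (ground k) (elements k) (cadd k) (cmul k) (copp k) (cconj k).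
Let kcompl := complements (ground k) (cadd k) (cmul k) (copp k) (cconj k).

Lemma is_c0_phi x : is_c0 x -> phi x = 0.
Proof. by case: x. Qed.

Lemma sieve_cons add mul opp conj' kap c1 ga th' n h l rows des :
  sieve add mul opp conj' kap c1 ga ((th', n, h, l) :: rows) des =
  let g := if kap then add ga th' else ga in
  let P := add (add (mul c1 (mul g (conj' g))) n)
    (opp (add (mul g h) (conj' (mul g h)))) in
  sieve add mul opp conj' kap c1 ga rows
    (filterb (fun de => if is_c0 (add P (mul de (add l (opp (mul c1 de)))))
                        then false else true) des).
Proof. by case: des => [|//]; case: rows. Qed.

Lemma mem_net (kap : bool) al be ta gas des ga de :
    ga \in gas -> de \in des -> conj (phi be) = phi be -> conj (phi de) = phi de ->
    (forall th, gram_det conj (phi al) (phi be) th (phi ta)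
       (phi ga + conj th *+ kap) (phi de) != 0) ->
  (ta, ga, de) \in knet kap al be ta gas des.
Proof.
move=> gain dein cbe cde ndet; apply/flattenP.
eexists; first exact: map_f gain.
apply: map_f; rewrite {gain}.
elim: (elements k) des dein => [|th s IHs] des dein; first by case: des dein.
rewrite sieve_cons; apply: IHs; rewrite filterbE mem_filter dein andbT.
case: ifP => // /is_c0_phi; move/eqP: (ndet (phi th)).
case: (kap); rewrite ?(phiD, phiM, phiN, phiC, phi1) /gram_det /norm /trace
  ?mulr1n ?mulr0n ?(rmorphD, rmorphM, rmorphN, rmorphXn, rmorph0, rmorph1)
  ?conjK ?cbe ?cde => nz z0; case: nz; rewrite -[RHS]z0; ring.
Qed.

(** The second form matters only modulo the first one and up to a scalar of F, which brings it to
    one of the [complements]; all coefficients are then values of codes, and the boolean search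
    applies. *)
Lemma search_sound kap reps tg3 al ta3 gas ga3 de3 al4 be4 ta4 ga4 de4 :
    search (ground k) (elements k) (cadd k) (cmul k) (copp k) (cconj k) kap
      reps tg3 ->
    al \in reps -> (ta3, gas) \in tg3 -> ga3 \in gas ->
    conj de3 = de3 -> conj be4 = be4 -> conj de4 = de4 ->
    nonsingular conj kap (phi al) (phi ta3) (phi ga3) de3 al4 be4 ta4 ga4 de4 ->
  [/\ be4 = 0, phi ta3 = 0, de3 = 0, ta4 = 0 & de4 = 0].
Proof.
move=> searchT alin tgin ga3in cde3 cbe4 cde4 ns.
have c0 : conj 0 = 0 by rewrite rmorph0.
have c1 : conj 1 = 1 by rewrite rmorph1.
have al0 : phi al != 0.
  apply/eqP => al0; have := ns (phi ta3) 1 0 c1 c0.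
  rewrite oner_eq0 andbF al0 => /(_ isT).
  by rewrite !(mul1r, mul0r, addr0) gram_det_null eqxx.
have [d3 d3in d3E] := ground_surj cde3.
suff main al4' be4' ta4' ga4' de4' :
    (al4', be4') \in kcompl al -> conj (phi be4') = phi be4' ->
    conj de4' = de4' ->
    nonsingular conj kap (phi al) (phi ta3) (phi ga3) de3
      (phi al4') (phi be4') ta4' ga4' de4' ->
    [/\ phi be4' = 0, phi ta3 = 0, de3 = 0, ta4' = 0 & de4' = 0].
  (* Here al4 = (x + y i) al, so subtracting x times the first form leaves y i al. *)
  have [x [y [cx cy al4E]]] := ground_span (al4 / phi al).
  have {}al4E : al4 - x * phi al = y * phi c01 * phi al.
    by apply/eqP; rewrite subr_eq -mulrDl addrC -al4E divfK.
  have [be0|be0] := eqVneq be4 0.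
    (* If y = 0, the difference has al = be = 0 and [gram_det_null] makes it degenerate. *)
    have y0 : y != 0.
      apply/eqP => y0; have cNx : conj (- x) = - x by rewrite rmorphN /= cx.
      have := ns (ta4 - x * phi ta3) _ _ cNx c1.
      rewrite oner_eq0 !andbF => /(_ isT).
      rewrite be0 mulr0 !mul1r.
      rewrite (_ : - x * phi al + al4 = 0); last by rewrite addrC mulNr al4E y0 !mul0r.
      by rewrite [_ * _ + ta4]addrC mulNr gram_det_null eqxx.
    have iy0 : y^-1 != 0 by rewrite invr_eq0.
    have ciy : conj y^-1 = y^-1 by rewrite fmorphV cy.
    have := nonsingular_reduce cx ciy iy0 ns.
    rewrite al4E be0 mulr0 -!mulrA mulKf // => ns'.
    have [] := main (cmul k c01 al) c00 (y^-1 * (ta4 - x * phi ta3))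
      (y^-1 * (ga4 - x * phi ga3)) (y^-1 * (de4 - x * de3)).
    - exact: mem_head.
    - by rewrite phi0.
    - by rewrite !(rmorphM, rmorphB) /= ciy cx cde3 cde4.
    - by rewrite phiM phi0.
    move=> _ ta30 de30 /eqP ta40 /eqP.
    rewrite de30 mulr0 subr0 mulf_eq0 (negbTE iy0) => /eqP de40.
    move: ta40; rewrite ta30 mulr0 subr0 mulf_eq0 (negbTE iy0) => /eqP ta40.
    by split.
  have ib0 : be4^-1 != 0 by rewrite invr_eq0.
  have cib : conj be4^-1 = be4^-1 by rewrite fmorphV cbe4.
  have [t tin tE] : exists2 c, c \in ground k & phi c = be4^-1 * y.
    by apply: ground_surj; rewrite rmorphM /= cib cy.
  have ns' := nonsingular_reduce cx cib ib0 ns.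
  have [] := main (cmul k t (cmul k c01 al)) c10 (be4^-1 * (ta4 - x * phi ta3))
      (be4^-1 * (ga4 - x * phi ga3)) (be4^-1 * (de4 - x * de3)).
  - rewrite inE; apply/orP; right.
    apply: map_f; rewrite filterbE mem_filter.
    rewrite (map_f (fun u => cmul k u (cmul k c01 al)) tin) andbT allbE.
    apply/allP => s sin; case: ifP => // /is_c0_phi.
    rewrite ?(phiD, phiM, phiN, phiC, phi1) tE => /eqP; rewrite subr_eq0 => /eqP nrm1.
    have cs : conj (phi s) = phi s by apply: ground_conj.
    set a := _ + _ * _ in nrm1.
    pose d := phi s * de3 + be4^-1 * (de4 - x * de3).
    have cd : conj d = d.
      by rewrite rmorphD !rmorphM rmorphB rmorphM /= cs cib cx cde3 cde4.
    (* This is the th of [gram_det_degenerate] for s times the first form plus the reduced second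
       one, where be = 1. *)
    have := ns' (conj (phi s * phi ta3 + be4^-1 * (ta4 - x * phi ta3)) * a / 1) _ _ cs c1.
    rewrite oner_eq0 !andbF => /(_ isT).
    rewrite al4E mulVf // !mul1r (_ : phi s * phi al + _ = a); last first.
      by rewrite /a addrC -!mulrA.
    by rewrite gram_det_degenerate ?eqxx ?oner_eq0 // expr1n.
  - by rewrite phi1.
  - by rewrite !(rmorphM, rmorphB) /= cib cx cde3 cde4.
  - by rewrite !phiM phi1 tE -(mulVf be0) -!mulrA [y * _]mulrA -al4E.
  by rewrite phi1 => /eqP; rewrite oner_eq0.
move=> p4in cbe4' cde4' ns'.
have [t4 t4in t4E] := elements_surj ta4'.
have [g4 g4in g4E] := elements_surj ga4'.
have [d4 d4in d4E] := ground_surj cde4'.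
rewrite -t4E -g4E -d4E -d3E in ns' *.
have in3 : (ta3, ga3, d3) \in knets kap al c00 tg3.
  apply/flattenP; eexists; first exact: (map_f _ tgin).
  apply: mem_net => //; rewrite ?phi0 //; first exact: ground_conj.
  move=> th; have := ns' th 1 0 c1 c0; rewrite oner_eq0 andbF => /(_ isT).
  by rewrite !mul1r !mul0r !addr0.
have in4 : (t4, g4, d4) \in knets kap al4' be4' (all_tg (elements k)).
  apply/flattenP; eexists; first exact: (map_f _ (map_f _ t4in)).
  apply: mem_net => //; first exact: ground_conj.
  move=> th; have := ns' th 0 1 c0 c1; rewrite oner_eq0 !andbF => /(_ isT).
  by rewrite !mul1r !mul0r !add0r.
move: searchT; rewrite /search allbE => /allP/(_ _ alin).
rewrite allbE => /allP/(_ _ p4in); rewrite allbE => /allP/(_ _ in3).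
rewrite allbE => /allP/(_ _ in4) /=.
case: ifP.
  rewrite /is_diagonal.
  by do 4![case: ifP => // /is_c0_phi ?]; move=> /is_c0_phi ?; split.
move=> _; rewrite /excluded exbE => /hasP[z zin netE].
have cz : conj (phi z) = phi z by apply: ground_conj; apply: mem_behead.
suff: (cadd k (cmul k z ta3) t4, cadd k (cmul k z ga3) g4,
       cadd k (cmul k z d3) d4) \in
    knet kap (cadd k (cmul k z al) al4') be4' (cadd k (cmul k z ta3) t4)
      [:: cadd k (cmul k z ga3) g4] [:: cadd k (cmul k z d3) d4].
  by move: netE; rewrite /knet; case: (net _ _ _ _ _ _ _ _ _ _ _).
apply: mem_net; rewrite ?mem_head //.
  by rewrite phiD phiM rmorphD rmorphM /= cz !ground_conj.
move=> th; have := ns' th _ _ cz c1; rewrite oner_eq0 !andbF => /(_ isT).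
by rewrite !phiD !phiM !mul1r.
Qed.

End SearchSound.

Lemma digit_ofK : cancel val_digit digit_of.
Proof. by case. Qed.

HB.instance Definition _ := Equality.copy digit (can_type digit_ofK).

Lemma val_digit_of n : (n < 9)%N -> val_digit (digit_of n) = n.
Proof. by do 9![case: n => [|n] //]. Qed.

Lemma tab_digit2E f x y : tab_digit2 f x y = f x y.
Proof. by case: x; case: y. Qed.

Definition digit_invertible k x :=
  has (fun y => dig_mul k x y == d1) (dig_list k).

(** Everything is phrased through invertible digits, since a morphism sends these to nonzero
    elements of F: differences of listed digits give injectivity, 1 + 1 excludes characteristic 2,
    and x x - lam makes lam a nonsquare. The first clause runs over all nine digits because
    [psi_opp] is stated for all of them. *)
Definition digits_ok k :=
  [&& all (fun x => dig_add k x (dig_opp k x) == d0) digits,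
      pairwise (fun x y => digit_invertible k (dig_add k x (dig_opp k y)))
        (dig_list k),
      digit_invertible k (dig_add k d1 d1) &
      all (fun x => digit_invertible k
        (dig_add k (dig_mul k x x) (dig_opp k (dig_lam k)))) (dig_list k)].

Definition digit_morphism (F : pzRingType) k (psi : digit -> F) :=
  [/\ psi d0 = 0, psi d1 = 1,
      {morph psi : x y / dig_add k x y >-> x + y} &
      {morph psi : x y / dig_mul k x y >-> x * y}].

(** * Realizing the digits in F *)

Section DigitModels.

Variable F : finFieldType.

Section Morphism.

Variables (k : digit_field) (psi : digit -> F).
Hypotheses (kok : digits_ok k) (psiM : digit_morphism k psi).

Lemma psi_opp x : psi (dig_opp k x) = - psi x.
Proof.
have [psi0 _ psiD _] := psiM; apply/eqP; rewrite -addr_eq0 addrC -psiD.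
case/and4P: kok => /allP/(_ x) okx _ _ _.
have xin : x \in digits by case: (x).
by rewrite (eqP (okx xin)) psi0.
Qed.

Lemma digit_invertible_neq0 x : digit_invertible k x -> psi x != 0.
Proof.
have [_ psi1 _ psiMul] := psiM => /hasP[y _ /eqP xy].
apply/eqP => x0; have /eqP := psiMul x y.
by rewrite xy psi1 x0 mul0r oner_eq0.
Qed.

Lemma digit_two_neq0 : 2 != 0 :> F.
Proof.
have [_ psi1 psiD _] := psiM; case/and4P: kok => _ _ + _.
by move/digit_invertible_neq0; rewrite psiD psi1.
Qed.

Lemma digit_surj : size (dig_list k) = #|F| ->
  forall x, exists2 d, d \in dig_list k & psi d = x.
Proof.
have [_ _ psiD _] := psiM => szk x.
have uniq_psi : uniq (map psi (dig_list k)).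
  case/and4P: kok => _ + _ _; rewrite uniq_pairwise pairwise_map.
  apply: sub_pairwise => y z /digit_invertible_neq0.
  by rewrite psiD psi_opp subr_eq0.
have [_ all_psi] := uniq_min_size uniq_psi
  (fun y _ => mem_enum F y) (eq_leq (etrans (esym (cardE F)) (etrans (esym szk) (esym (size_map _ _))))).
have : x \in map psi (dig_list k) by rewrite all_psi mem_enum.
by case/mapP => d din ->; exists d.
Qed.

Lemma digit_lam_nonsquare : size (dig_list k) = #|F| ->
  forall x, x ^+ 2 != psi (dig_lam k).
Proof.
have [_ _ psiD psiMul] := psiM => szk x.
have [d din <-] := digit_surj szk x; case/and4P: kok => _ _ _ /allP/(_ d din).
by move/digit_invertible_neq0; rewrite psiD psi_opp psiMul subr_eq0 expr2.
Qed.

End Morphism.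

Lemma natr_mod p n : p%:R = 0 :> F -> (n %% p)%:R = n%:R :> F.
Proof. by move=> p0; rewrite [in RHS](divn_eq n p) natrD natrM p0 mulr0 add0r. Qed.

Lemma prime_digit_morphism p lam : (1 < p <= 9)%N -> p%:R = 0 :> F ->
  digit_morphism (tabulate_digits (prime_digits p lam))
    (fun x => (val_digit x)%:R : F).
Proof.
move=> /andP[p1 p9] p0; have lt9 n : (n %% p < 9)%N.
  by apply: leq_trans p9; rewrite ltn_mod ltnW.
split=> // x y; rewrite /= tab_digit2E val_digit_of ?lt9 // natr_mod //.
  by rewrite natrD.
by rewrite natrM.
Qed.

Lemma nine_digit_morphism (j : F) : 3%:R = 0 :> F -> j ^+ 2 = -1 ->
  digit_morphism (tabulate_digits nine_digits)
    (fun x => (val_digit x %% 3)%:R + (val_digit x %/ 3)%:R * j).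
Proof.
move=> c3 j2.
have encE a b : (val_digit (digit_of (a %% 3 + 3 * (b %% 3))) %% 3)%:R +
    (val_digit (digit_of (a %% 3 + 3 * (b %% 3))) %/ 3)%:R * j = a%:R + b%:R * j.
  have lta : (a %% 3 < 3)%N by rewrite ltn_mod.
  rewrite val_digit_of; last first.
    have : (b %% 3 < 3)%N by rewrite ltn_mod.
    by case: (b %% 3)%N (a %% 3)%N lta => [|[|[|]]] // [|[|[|]]].
  rewrite addnC mulnC modnMDl modn_mod natr_mod // divnMDl // (divn_small lta).
  by rewrite addn0 natr_mod.
split=> [||x y|x y]; rewrite /= ?tab_digit2E ?encE ?mul0r ?addr0 //.
  by rewrite !natrD; ring.
(* The digit product has the natural number 2 where j^2 = -1 is meant. *)
have two : 2 = j ^+ 2 by apply/eqP; rewrite j2 -addr_eq0 natr1 c3.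
by rewrite !natrD !natrM; ring: two.
Qed.

(** All nine elements are roots of x^9 - x = (x^5 - x) (x^4 + 1), and at most five of them are roots
    of the first factor. *)
Lemma sqrtN1 : #|F| = 9%N -> exists j : F, j ^+ 2 = -1.
Proof.
move=> F9; have /existsP[x x5] : [exists x : F, x ^+ 5 != x].
  apply: contraT; rewrite negb_exists => /forallP all5.
  have szp : size ('X^5 - 'X : {poly F}) = 6%N.
    by rewrite size_polyDl ?size_polyN ?size_polyX ?size_polyXn.
  have p0 : 'X^5 - 'X != 0 :> {poly F} by rewrite -size_poly_eq0 szp.
  have rts : all (root ('X^5 - 'X)) (enum F).
    apply/allP => x _; rewrite rootE !hornerE subr_eq0.
    by have := all5 x; rewrite negbK.
  by have := max_poly_roots p0 rts (enum_uniq F); rewrite -cardE F9 szp.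
exists (x ^+ 2).
have x9 : x ^+ 9 = x by rewrite -{1}F9 expf_card.
have : (x ^+ 5 - x) * ((x ^+ 2) ^+ 2 + 1) = 0.
  rewrite (_ : _ * _ = x ^+ 9 - x); last ring.
  by rewrite x9 subrr.
move/eqP; rewrite mulf_eq0 subr_eq0 (negbTE x5) addr_eq0 => /eqP //.
Qed.

Lemma digit_models q : q \in [:: 3; 5; 7; 9]%N -> #|F| = q ->
  exists2 psi : digit -> F, digit_morphism (digits_for q) psi &
    size (dig_list (digits_for q)) = #|F|.
Proof.
have pF p n : #|F| = (p ^ n)%N -> prime p -> p%:R = 0 :> F.
  by move=> Fpn p_pr; have /pcharf0 := card_finPcharP Fpn p_pr.
rewrite !inE => /or4P[] /eqP-> Fq; rewrite Fq /digits_for.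
- exists (fun x => (val_digit x)%:R) => //.
  by apply: (@prime_digit_morphism 3 d2); rewrite ?(pF 3 1%N).
- exists (fun x => (val_digit x)%:R) => //.
  by apply: (@prime_digit_morphism 5 d2); rewrite ?(pF 5 1%N).
- exists (fun x => (val_digit x)%:R) => //.
  by apply: (@prime_digit_morphism 7 d3); rewrite ?(pF 7 1%N).
have [j j2] := sqrtN1 Fq.
exists (fun x => (val_digit x %% 3)%:R + (val_digit x %/ 3)%:R * j) => //.
by apply: nine_digit_morphism; rewrite ?(pF 3 2%N).
Qed.

End DigitModels.

Lemma digits_for_ok q : q \in [:: 3; 5; 7; 9]%N -> digits_ok (digits_for q).
Proof. by rewrite !inE => /or4P[] /eqP->; vm_compute. Qed.

(** * The fields F and F(i) *)

Lemma quadratic_extension (F : finFieldType) (lam : F) :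
    (forall x, x ^+ 2 != lam) ->
  exists (L : splittingFieldType F) (sigma : gal_of {:L}) (i : L),
    [/\ \dim {:L} = 2%N, sigma \in ('Gal({:L} / 1))%g, i ^+ 2 = lam%:A,
        sigma i = - i & forall x : L, exists a b : F, x = a%:A + b%:A * i].
Proof.
move=> lam_ns.
have szp : size ('X^2 - lam%:P) = 3%N.
  by rewrite size_polyDl ?size_polyN ?size_polyXn // size_polyC; case: eqP.
have p0 : 'X^2 - lam%:P != 0 by rewrite -size_poly_eq0 szp.
have [L [rs Dp defL]] := FinSplittingFieldFor p0.
rewrite rmorphB /= map_polyXn map_polyC /= in Dp.
have szL : size ('X^2 - (lam%:A)%:P : {poly L}) = 3%N.
  by rewrite size_polyDl ?size_polyN ?size_polyXn // size_polyC; case: eqP.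
have rootE (x : L) : root ('X^2 - (lam%:A)%:P) x = (x ^+ 2 == lam%:A).
  by rewrite rootE !hornerE subr_eq0.
have [i irs] : exists i, i \in rs.
  have := eqp_size Dp; rewrite szL size_prod_XsubC => - [].
  by case: rs {Dp defL} => // i rs _; exists i; apply: mem_head.
have rsE x : x \in rs -> x ^+ 2 = lam%:A.
  by move=> xrs; apply/eqP; rewrite -rootE (eqp_root Dp) root_prod_XsubC.
have i2 := rsE i irs.
have i_notin : i \notin 1%VS.
  apply/negP => /vlineP[c ic]; have /eqP[] := lam_ns c.
  by apply: (fmorph_inj (in_alg L)); rewrite rmorphXn /= -ic.
have defLi : <<1; i>>%VS = fullv.
  apply/eqP; rewrite eqEsubv subvf /= -defL; apply/Fadjoin_seqP.
  split; first exact: sub1v.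
  move=> x /rsE /eqP; rewrite -i2 eqf_sqr => /orP[]/eqP->.
    exact: memv_adjoin.
  by rewrite rpredN memv_adjoin.
have deg2 : adjoin_degree 1 i = 2%N.
  apply/eqP; rewrite eqn_leq; apply/andP; split; last first.
    by rewrite ltn_neqAle eq_sym adjoin_deg_eq1 i_notin.
  rewrite -ltnS -size_minPoly -szL; apply: dvdp_leq; first by rewrite -size_poly_eq0 szL.
  apply: minPoly_dvdp; last by rewrite rootE i2.
  by rewrite rpredB ?rpredX ?polyOverX // polyOverC rpredZ ?mem1v.
have dimL : \dim {:L} = 2%N by rewrite -defLi dim_Fadjoin deg2 dimv1.
have span x : exists a b : F, x = a%:A + b%:A * i.
  have /Fadjoin_poly_eq <- : x \in <<1; i>>%VS by rewrite defLi memvf.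
  have /polyOverP p1 := Fadjoin_polyOver 1 i x.
  have := size_Fadjoin_poly 1 i x; rewrite deg2 => /horner_coef_wide->.
  rewrite !big_ord_recl big_ord0 /= expr0 expr1 mulr1 addr0.
  by have /vlineP[a ->] := p1 0%N; have /vlineP[b ->] := p1 1%N; exists a, b.
have [sigma galS sigi] : exists2 sigma, sigma \in ('Gal({:L} / 1))%g & sigma i != i.
  have /galois_fixedField fix1 := finField_galois (sub1v {:L}%AS).
  apply/exists_inP; apply: contraNT i_notin; rewrite negb_exists_in.
  move=> /forall_inP fixi; rewrite -fix1; apply/fixedFieldP; first exact: memvf.
  by move=> x /fixi; rewrite negbK => /eqP.
exists L, sigma, i; split=> //.
have : (sigma i) ^+ 2 == i ^+ 2 by rewrite -rmorphXn /= i2 rmorph_alg.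
by rewrite eqf_sqr (negbTE sigi) => /eqP.
Qed.

Section QuadraticExtension.

Variables (F : fieldType) (L : fieldExtType F) (conj : {lrmorphism L -> L}).
Variables (i : L) (lam : F).
Hypothesis conj_i : conj i = - i.
Hypothesis i2 : i ^+ 2 = lam%:A.
Hypothesis span_i : forall x : L, exists a b : F, x = a%:A + b%:A * i.
Hypothesis lam_ns : forall x, x ^+ 2 != lam.
Hypothesis two_neq0 : 2 != 0 :> F.

Lemma ext_two_neq0 : 2 != 0 :> L.
Proof. by rewrite -(rmorph_nat (in_alg L)) fmorph_eq0. Qed.

Lemma ext_i_neq0 : i != 0.
Proof.
apply: contraTneq (lam_ns 0) => i0; rewrite negbK.
by rewrite -(fmorph_eq (in_alg L)) rmorphXn rmorph0 /= -i2 i0.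
Qed.

Lemma conj_fixed x : conj x = x -> exists a : F, x = a%:A.
Proof.
have [a [b ->]] := span_i x; exists a; move/eqP: H.
rewrite rmorphD rmorphM /= !rmorph_alg conj_i -subr_eq0.
rewrite (_ : _ - _ = - (2 * (b%:A * i))); last by ring.
rewrite oppr_eq0 mulf_eq0 (negbTE ext_two_neq0) /= => /eqP->.
by rewrite addr0.
Qed.

Lemma conjK : involutive conj.
Proof.
move=> x; have [a [b ->]] := span_i x.
by rewrite !(rmorphD, rmorphM) /= !rmorph_alg conj_i rmorphN /= conj_i opprK.
Qed.

Lemma alg_i_eq0 (a b : F) : a%:A + b%:A * i = 0 -> a = 0 /\ b = 0.
Proof.
move=> e; have : conj (a%:A + b%:A * i) = 0 by rewrite e rmorph0.
rewrite rmorphD rmorphM /= !rmorph_alg conj_i => e'.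
have /eqP : 2 * a%:A = 0 :> L.
  by have := congr2 +%R e e'; rewrite addr0 => <-; ring.
rewrite mulf_eq0 (negbTE ext_two_neq0) /= => /eqP a0.
move/eqP: e; rewrite a0 add0r mulf_eq0 (negbTE ext_i_neq0) orbF => /eqP b0.
by split; apply: (fmorph_inj (in_alg L)); rewrite rmorph0.
Qed.

End QuadraticExtension.

(** * Computed facts about scalings and squares in L *)

Section CodeChecks.

Variable q : nat.
Let k := codes_for q.
Let els := elements k.
Let add := cadd k.
Let mul := cmul k.
Let sub x y := add x (copp k y).

Definition code_invertible x := has (fun y => mul x y == c10) els.

(** The substitutions allowed by [nonsingular_scale]. With a twist x = (conj y)^2 / y, so al is
    multiplied by x^2 = y^(4 q - 2), which is y^(-6) up to a factor in F. Modulo the nonzero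
    elements of F, those of L form a cyclic group of order q + 1, so there are gcd (6, q + 1)
    classes of al: six for q = 5, two for q = 3, 7, 9. *)
Definition scalings (kap : bool) : seq (code * code) :=
  if kap then [seq p <- [seq (x, y) | x <- behead els, y <- behead els] |
    mul p.1 p.2 == mul (cconj k p.2) (cconj k p.2)]
  else [seq (x, c10) | x <- behead els].

Definition scaling_cover kap (reps : seq code) := all (fun al =>
  has (fun p => has (fun c => mul c (mul al (mul p.1 p.1)) \in reps)
    (behead (ground k))) (scalings kap)) (behead els).

Definition square_cover g := all (fun ga =>
  has (fun y => mul ga (mul y y) \in [:: c00; c10; g]) (behead els)) els.

(** The expression v^2 - 4 d w^2 is the discriminant of d al^2 - v al + w^2, whose roots al give
    degenerate forms in [untwist]. *)
Definition nonsquare_check := all (fun u => all (fun d => cis_square k d ||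
  has (fun w =>
    let v := add (mul u w) (cconj k w) in
    cis_square k (sub (mul v v) (mul (add c10 (add c10 (add c10 c10)))
       (mul d (mul w w))))) (behead els)) els) els.

Definition semilinear_check := all (fun m => all (fun n =>
  has (fun al => cis_square k (mul al (add (mul m al) (mul n (cconj k al)))))
    (behead els)) (behead els)) (behead els).

Definition codes_ok :=
  [&& head c10 els == c00, head c10 (ground k) == c00,
      all code_invertible (behead els), all code_invertible (behead (ground k)),
      scaling_cover false [:: c10; nonsquare_for q],
      scaling_cover true (twisted_reps_for q),
      square_cover (nonsquare_for q), nonsquare_check & semilinear_check].

End CodeChecks.

Lemma codes_for_ok q : q \in [:: 3; 5; 7; 9]%N -> codes_ok q.
Proof. by rewrite !inE => /or4P[] /eqP->; vm_compute. Qed.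

Lemma plain_searchP q : q \in [:: 3; 5; 7; 9]%N -> plain_search q.
Proof. by rewrite !inE => /or4P[] /eqP->; vm_compute. Qed.

Lemma twisted_searchP q : q \in [:: 3; 5; 7; 9]%N -> twisted_search q.
Proof. by rewrite !inE => /or4P[] /eqP->; vm_compute. Qed.

Lemma codes_forE q : q \in [:: 3; 5; 7; 9]%N ->
  codes_for q = tabulate_codes (digits_for q).
Proof. by rewrite !inE => /or4P[] /eqP->; vm_compute. Qed.

(* The second clause excludes kap = 1 with a nonsquare n^^2 - m, and the third
   one kap = 0 with m and n nonzero. *)
Definition search_facts (L : fieldType) (conj : {rmorphism L -> L}) :=
  [/\ forall (kap : bool) al3 ta3 ga3 de3 al4 be4 ta4 ga4 de4,
        conj de3 = de3 -> conj be4 = be4 -> conj de4 = de4 ->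
        nonsingular conj kap al3 ta3 ga3 de3 al4 be4 ta4 ga4 de4 ->
        [/\ be4 = 0, ta3 = 0, de3 = 0, ta4 = 0 & de4 = 0],
      forall u d, (exists x, d = x ^+ 2) \/
        exists w x, w != 0 /\ (u * w + conj w) ^+ 2 - 4 * (d * w ^+ 2) = x ^+ 2 &
      forall m n, m != 0 -> n != 0 ->
        exists al x, al != 0 /\ al * (m * al + n * conj al) = x ^+ 2].

Lemma tab_code1E A (f : code -> A) x : tab_code1 f x = f x.
Proof. by case: x. Qed.

Lemma re_mk a b : re (mk_code a b) = a.
Proof. by case: a; case: b. Qed.

Lemma im_mk a b : im (mk_code a b) = b.
Proof. by case: a; case: b. Qed.

Section CodeModel.

Variables (F : finFieldType) (q : nat) (psi : digit -> F).
Hypothesis q_cases : q \in [:: 3; 5; 7; 9]%N.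
Let d := digits_for q.
Hypothesis psiP : digit_morphism d psi.
Hypothesis dF : size (dig_list d) = #|F|.

Variables (L : fieldExtType F) (conj : {lrmorphism L -> L}) (i : L).
Hypothesis conj_i : conj i = - i.
Hypothesis i2 : i ^+ 2 = (psi (dig_lam d))%:A.
Hypothesis span_i : forall x : L, exists a b : F, x = a%:A + b%:A * i.

Let dok : digits_ok d := digits_for_ok q_cases.
Let k := codes_for q.

Lemma psi_surj x : exists2 a, a \in dig_list d & psi a = x.
Proof. exact: digit_surj dok psiP dF x. Qed.

Definition code_value x : L := (psi (re x))%:A + (psi (im x))%:A * i.
Let phi := code_value.

Lemma code_value_mk a b : phi (mk_code a b) = (psi a)%:A + (psi b)%:A * i.
Proof. by rewrite /phi /code_value re_mk im_mk. Qed.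

Lemma code_value0 : phi c00 = 0.
Proof. by have [psi0 _ _ _] := psiP; rewrite (code_value_mk d0 d0) psi0 scale0r mul0r addr0. Qed.

Lemma code_value1 : phi c10 = 1.
Proof.
have [psi0 psi1 _ _] := psiP.
by rewrite (code_value_mk d1 d0) psi0 psi1 scale0r mul0r addr0 scale1r.
Qed.

Lemma code_value_i : phi c01 = i.
Proof.
have [psi0 psi1 _ _] := psiP.
by rewrite (code_value_mk d0 d1) psi0 psi1 scale0r scale1r add0r mul1r.
Qed.

Lemma code_valueD : {morph phi : x y / cadd k x y >-> x + y}.
Proof.
have [_ _ psiD _] := psiP => x y; rewrite /k codes_forE //= !tab_code1E.
by rewrite code_value_mk !psiD !scalerDl /phi /code_value; ring.
Qed.

Lemma code_valueM : {morph phi : x y / cmul k x y >-> x * y}.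
Proof.
have [_ _ psiD psiM] := psiP => x y; rewrite /k codes_forE //= !tab_code1E.
have algM a b : (a * b)%:A = a%:A * b%:A :> L by rewrite mulr_algl scalerA.
rewrite code_value_mk !(psiD, psiM) !scalerDl !algM -i2.
by rewrite /phi /code_value; ring.
Qed.

Lemma code_valueN : {morph phi : x / copp k x >-> - x}.
Proof.
move=> x; rewrite /k codes_forE //= !tab_code1E code_value_mk.
by rewrite !(psi_opp dok psiP) !scaleNr /phi /code_value; ring.
Qed.

Lemma code_valueC x : phi (cconj k x) = conj (phi x).
Proof.
rewrite /k codes_forE //= !tab_code1E code_value_mk (psi_opp dok psiP).
by rewrite /phi /code_value rmorphD rmorphM /= !rmorph_alg conj_i scaleNr; ring.
Qed.

Lemma elements_surj x : exists2 c, c \in elements k & phi c = x.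
Proof.
have [a [b ->]] := span_i x.
have [[da dain <-] [db dbin <-]] := (psi_surj a, psi_surj b).
exists (mk_code da db); last exact: code_value_mk.
by rewrite /k codes_forE //=; apply: allpairs_f.
Qed.

Lemma ground_conj x : x \in ground k -> conj (phi x) = phi x.
Proof.
rewrite /k codes_forE //= => /mapP[a ain ->]; have [psi0 _ _ _] := psiP.
by rewrite code_value_mk psi0 scale0r mul0r addr0 rmorph_alg.
Qed.

Let two_neq0 : 2 != 0 :> F := digit_two_neq0 dok psiP.
Let conjK := conjK conj_i span_i.
Let conj_fixed := conj_fixed conj_i span_i two_neq0.

Lemma ground_surj x : conj x = x -> exists2 c, c \in ground k & phi c = x.
Proof.
move=> /conj_fixed[a ->]; have [da dain <-] := psi_surj a.
exists (mk_code da d0); first by rewrite /k codes_forE //=; apply: map_f.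
by have [psi0 _ _ _] := psiP; rewrite code_value_mk psi0 scale0r mul0r addr0.
Qed.

Lemma code_invertible_neq0 x : code_invertible q x -> phi x != 0.
Proof.
case/hasP => y _ /eqP xy; apply/eqP => x0; have := code_valueM x y.
by rewrite xy code_value1 x0 mul0r => /eqP; rewrite oner_eq0.
Qed.

Lemma is_square_value x : cis_square k x -> exists y, phi x = y ^+ 2.
Proof.
rewrite /k codes_forE //= tab_code1E /qis_square exbE => /hasP[y _].
have -> : qadd d x (qopp d (qmul d y y)) = cadd k x (copp k (cmul k y y)).
  by rewrite /k codes_forE //= !tab_code1E.
case: (cadd _ _ _) (code_valueD x (copp k (cmul k y y))) => //.
rewrite code_value0 code_valueN code_valueM => /eqP.
by rewrite eq_sym subr_eq0 => /eqP-> _; exists (phi y); rewrite expr2.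
Qed.

(** The conclusions on forms say that coefficients vanish, which scaling does not affect. Hence al,
    and without twist also ta or ga, may be scaled to one of the values that were searched. *)
Lemma field_search_facts : search_facts conj.
Proof.
have /and5P[/eqP els0 /eqP gr0 /allP elsN0 /allP grN0] := codes_for_ok q_cases.
case/and5P=> /allP cov0 /allP cov1 /allP sqcov /allP nsq /allP semi.
have elsE x : x != 0 -> exists2 c, c \in behead (elements k) & phi c = x.
  have [c + <-] := elements_surj x; rewrite /k.
  case: (elements _) els0 => [//|c' s] /= ->; rewrite inE => /orP[/eqP->|]; last by exists c.
  by rewrite code_value0 eqxx.
have phi_ci x : exists y z, [/\ conj y = y, conj z = z & x = y + z * phi c01].
  have [a [b ->]] := span_i x; exists a%:A, b%:A.
  by rewrite code_value_i !rmorph_alg.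
have sound kap reps tg3 := @search_sound L conj conjK k phi code_value0 code_value1
  code_valueD code_valueM code_valueN code_valueC ground_conj ground_surj
  elements_surj phi_ci kap reps tg3.
have nN0 x : x != 0 -> norm conj x != 0.
  by move=> nx0; rewrite mulf_neq0 ?fmorph_eq0.
have nN x : conj (norm conj x) = norm conj x.
  by rewrite /norm rmorphM /= conjK mulrC.
have twisted rep ta3 ga3 de3 al4 be4 ta4 ga4 de4 :
    rep \in twisted_reps_for q ->
    conj de3 = de3 -> conj be4 = be4 -> conj de4 = de4 ->
    nonsingular conj true (phi rep) ta3 ga3 de3 al4 be4 ta4 ga4 de4 ->
  [/\ be4 = 0, ta3 = 0, de3 = 0, ta4 = 0 & de4 = 0].
  have [[ct ctin <-] [cg cgin <-]] := (elements_surj ta3, elements_surj ga3).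
  move=> repin cde3 cbe4 cde4.
  apply: (sound _ _ _ _ _ (elements k) _ _ _ _ _ _ _ (twisted_searchP q_cases)) => //.
  exact: map_f.
have normal_form rep ct cs ga3 de3 al4 be4 ta4 ga4 de4 :
    rep \in [:: c10; nonsquare_for q] ->
    (ct, cs) \in tg_normal k (nonsquare_for q) ->
    (exists2 c, c \in cs & phi c = ga3) ->
    conj de3 = de3 -> conj be4 = be4 -> conj de4 = de4 ->
    nonsingular conj false (phi rep) (phi ct) ga3 de3 al4 be4 ta4 ga4 de4 ->
  [/\ be4 = 0, phi ct = 0, de3 = 0, ta4 = 0 & de4 = 0].
  move=> repin ctin [cg cgin <-] cde3 cbe4 cde4.
  by apply: (sound _ _ _ _ _ cs _ _ _ _ _ _ _ (plain_searchP q_cases)).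
have plain rep ta3 ga3 de3 al4 be4 ta4 ga4 de4 :
    rep \in [:: c10; nonsquare_for q] ->
    conj de3 = de3 -> conj be4 = be4 -> conj de4 = de4 ->
    nonsingular conj false (phi rep) ta3 ga3 de3 al4 be4 ta4 ga4 de4 ->
  [/\ be4 = 0, ta3 = 0, de3 = 0, ta4 = 0 & de4 = 0].
  move=> repin cde3 cbe4 cde4 ns.
  have [y [ct [cs [y0 ctin ctE ga3in]]]] : exists y ct cs,
      [/\ y != 0, (ct, cs) \in tg_normal k (nonsquare_for q),
          phi ct = conj y * ta3 & exists2 c, c \in cs & phi c = ga3 * y ^+ 2].
    (* If ta3 is nonzero, y is chosen to make it 1; otherwise y is free to change ga3 by a
       square. *)
    have [->|ta30] := eqVneq ta3 0.
      have [cg cgin <-] := elements_surj ga3.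
      have /hasP[cy yin yE] := sqcov cg cgin.
      exists (phi cy), c00, [:: c00; c10; nonsquare_for q].
      rewrite (code_invertible_neq0 (elsN0 _ yin)) code_value0 mulr0.
      split=> //; first by rewrite !inE eqxx orbT.
      by eexists; first exact: yE; rewrite !code_valueM expr2.
    exists (conj ta3^-1), c10, (elements k).
    rewrite fmorph_eq0 invr_eq0 conjK mulVf // code_value1.
    split=> //; first exact: mem_head.
    exact: elements_surj.
  have untwisted : false -> 1 * y = conj y ^+ 2 by [].
  have := nonsingular_scale conjK (rmorph1 _) (oner_neq0 _) (oner_neq0 _) y0
    untwisted ns.
  rewrite !(expr1n, mulr1, mul1r) -ctE => ns'.
  have c3 : conj (norm conj y * de3) = norm conj y * de3.
    by rewrite rmorphM /= nN cde3.
  have cb : conj (norm conj 1 * be4) = norm conj 1 * be4.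
    by rewrite rmorphM /= nN cbe4.
  have c4 : conj (norm conj y * de4) = norm conj y * de4.
    by rewrite rmorphM /= nN cde4.
  have [] := normal_form _ _ _ _ _ _ _ _ _ _ repin ctin ga3in c3 cb c4 ns'.
  have n1 : norm conj 1 = 1 by rewrite /norm rmorph1 mulr1.
  rewrite n1 mul1r ctE => -> /eqP + /eqP + /eqP + /eqP.
  rewrite !mulf_eq0 !fmorph_eq0 (negbTE y0) /=.
  by move=> /eqP-> /eqP-> /eqP-> /eqP->.
have diag (kap : bool) al3 ta3 ga3 de3 al4 be4 ta4 ga4 de4 :
    conj de3 = de3 -> conj be4 = be4 -> conj de4 = de4 ->
    nonsingular conj kap al3 ta3 ga3 de3 al4 be4 ta4 ga4 de4 ->
  [/\ be4 = 0, ta3 = 0, de3 = 0, ta4 = 0 & de4 = 0].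
  move=> cde3 cbe4 cde4 ns.
  have al30 : al3 != 0.
    apply/eqP => al30; have := ns ta3 1 0 (rmorph1 _) (rmorph0 _).
    rewrite oner_eq0 andbF al30 => /(_ isT).
    by rewrite !(mul1r, mul0r, addr0) gram_det_null eqxx.
  have [ca cain caE] := elsE al3 al30.
  have cov : has (fun p => has (fun c =>
      cmul k c (cmul k ca (cmul k p.1 p.1)) \in
        if kap then twisted_reps_for q else [:: c10; nonsquare_for q])
      (behead (ground k))) (scalings q kap).
    by case: (kap); [apply: cov1 | apply: cov0].
  case/hasP: cov => [[cx cy] /= scal /hasP[c cin repin]].
  have cgr : c \in ground k by apply: mem_behead.
  have c0 : phi c != 0 by apply/code_invertible_neq0/grN0.
  have [x0 y0 xy] : [/\ phi cx != 0, phi cy != 0 &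
      kap -> phi cx * phi cy = conj (phi cy) ^+ 2].
    move: scal; rewrite /scalings; case: (kap).
      rewrite mem_filter => /andP[/eqP /= xy /allpairsP[[x y] /= [xin yin [cxE cyE]]]].
      rewrite cxE cyE !(code_invertible_neq0 (elsN0 _ _)) //; split=> // _.
      by rewrite -cxE -cyE -code_valueM xy code_valueM code_valueC expr2.
    case/mapP=> x xin [-> ->]; rewrite (code_invertible_neq0 (elsN0 _ _)) //.
    by rewrite code_value1 oner_eq0.
  have cc : conj (phi c) = phi c by apply: ground_conj.
  have := nonsingular_scale conjK cc c0 x0 y0 xy ns.
  rewrite -caE (expr2 (phi cx)) -!code_valueM.
  move=> ns'.
  suff : [/\ norm conj (phi cx) * be4 = 0,
      phi c * (phi cx * conj (phi cy) * ta3) = 0,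
      phi c * (norm conj (phi cy) * de3) = 0,
      phi cx * conj (phi cy) * ta4 = 0 & norm conj (phi cy) * de4 = 0].
    case=> /eqP + /eqP + /eqP + /eqP + /eqP.
    rewrite !mulf_eq0 !fmorph_eq0 (negbTE x0) (negbTE y0) (negbTE c0) /=.
    by move=> /eqP-> /eqP-> /eqP-> /eqP-> /eqP->.
  have cN3 : conj (phi c * (norm conj (phi cy) * de3)) = phi c * (norm conj (phi cy) * de3).
    by rewrite 2!rmorphM /= nN cc cde3.
  have cNb : conj (norm conj (phi cx) * be4) = norm conj (phi cx) * be4.
    by rewrite rmorphM /= nN cbe4.
  have cN4 : conj (norm conj (phi cy) * de4) = norm conj (phi cy) * de4.
    by rewrite rmorphM /= nN cde4.
  by case: (kap) ns' repin => ns' repin; [apply: twisted ns'|apply: plain ns'].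
split=> [kap al3 ta3 ga3 de3 al4 be4 ta4 ga4 de4 cde3 cbe4 cde4 ns|u e|m n m0 n0].
- exact: diag ns.
- have [cu uin <-] := elements_surj u; have [ce ein <-] := elements_surj e.
  have := nsq cu uin => /allP/(_ ce ein)/orP[/is_square_value[x ex]|].
    by left; exists x; rewrite -ex.
  case/hasP=> w win /is_square_value[x xE]; right; exists (phi w), x.
  split; first exact: code_invertible_neq0 (elsN0 _ win).
  rewrite -xE !(code_valueD, code_valueM, code_valueN, code_value1, code_valueC).
  by ring.
have [cm min mE] := elsE m m0; have [cn nin nE] := elsE n n0.
have := semi cm min => /allP/(_ cn nin)/hasP[al alin /is_square_value[x xE]].
exists (phi al), x; split; first exact: code_invertible_neq0 (elsN0 _ alin).
by rewrite -xE -mE -nE !(code_valueD, code_valueM, code_valueC).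
Qed.

End CodeModel.

(** * Symmetric bilinear forms on L^2 *)

Section GramForm.

Variables (L : fieldType) (conj : {rmorphism L -> L}).
Hypothesis conjK : involutive conj.

(** With be and de fixed by [conj] there are ten parameters over F, as many as a symmetric bilinear
    form on F^4 has. The hermitian terms are those of be, ta and de. *)
Definition bform al be th ta ga de (x y x' y' : L) :=
  trace conj (al * (x * x')) + be * (x * conj x' + conj x * x')
  + trace conj (th * (x * y' + x' * y))
  + trace conj (ta * (x * conj y' + x' * conj y))
  + trace conj (ga * (y * y')) + de * (y * conj y' + conj y * y').

Definition gram_entry al be th ta ga de (r s : nat) : L :=
  nth 0 (nth [::]
    [:: [:: al; be; th; ta];
        [:: be; conj al; conj ta; conj th];
        [:: th; conj ta; ga; de];
        [:: ta; conj th; de; conj ga]] r) s.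

Lemma det_mx33 (f : nat -> nat -> L) : \det (\matrix_(r < 3, s < 3) f r s) =
  f 0 0 * (f 1 1 * f 2 2 - f 1 2 * f 2 1)
  - f 0 1 * (f 1 0 * f 2 2 - f 1 2 * f 2 0)
  + f 0 2 * (f 1 0 * f 2 1 - f 1 1 * f 2 0).
Proof.
rewrite (expand_det_row _ 0) !big_ord_recl big_ord0 /cofactor.
do 2 rewrite !(expand_det_row _ 0) !big_ord_recl !big_ord0 /cofactor.
by rewrite !det_mx00 !mxE /= /bump /=; ring.
Qed.

Lemma minor_mx44 (f : nat -> nat -> L) (r0 s0 : 'I_4) :
  row' r0 (col' s0 (\matrix_(r < 4, s < 4) f r s)) =
  \matrix_(r < 3, s < 3) f (bump r0 r) (bump s0 s).
Proof. by apply/matrixP=> r s; rewrite !mxE. Qed.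

Lemma det_gram al be th ta ga de : conj be = be -> conj de = de ->
  \det (\matrix_(r < 4, s < 4) gram_entry al be th ta ga de r s)
  = gram_det conj al be th ta ga de.
Proof.
move=> cbe cde; set f := gram_entry _ _ _ _ _ _.
rewrite (expand_det_row _ 0) !big_ord_recl big_ord0 /cofactor !(minor_mx44 f).
rewrite !(det_mx33 (fun r s => f (bump _ r) (bump _ s))) !mxE.
rewrite /= /bump /= /f /gram_entry /=.
rewrite /gram_det /norm /trace.
rewrite ?(rmorphD, rmorphB, rmorphM, rmorphXn, rmorph_nat, rmorphN) /=.
by rewrite ?conjK ?cbe ?cde; ring.
Qed.

(** A null vector (a, b, c, d) of the Gram matrix has unrelated coordinates, whereas a point of L^2
    gives (x, x^, y, y^). The kernel is stable under the semilinear involution with image (b^, a^,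
    d^, c^), so the sum of the vector and its image comes from L^2, and so does i times their
    difference. Both are zero only if the vector is. *)
Lemma bform_degenerate i al be th ta ga de :
    2 != 0 :> L -> conj be = be -> conj de = de -> i != 0 -> conj i = - i ->
    gram_det conj al be th ta ga de = 0 ->
  exists x y, ~~ ((x == 0) && (y == 0)) /\
    forall x' y', bform al be th ta ga de x y x' y' = 0.
Proof.
move=> two0 cbe cde i0 ci /eqP; rewrite -det_gram // => /det0P[v v0 /rowP vG].
pose a := v 0 (Ordinal (isT : 0 < 4)%N); pose b := v 0 (Ordinal (isT : 1 < 4)%N).
pose c := v 0 (Ordinal (isT : 2 < 4)%N); pose d := v 0 (Ordinal (isT : 3 < 4)%N).
have E r : a * gram_entry al be th ta ga de 0 (r : 'I_4) + b * gram_entry al be th ta ga de 1 r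
    + c * gram_entry al be th ta ga de 2 r + d * gram_entry al be th ta ga de 3 r = 0.
  have := vG r; rewrite !mxE !big_ord_recl big_ord0 !mxE /= addr0 !addrA => <-.
  by congr (_ * _ + _ * _ + _ * _ + _ * _); congr (v _ _); apply: val_inj.
have := E (Ordinal (isT : 0 < 4)%N); have := E (Ordinal (isT : 1 < 4)%N).
have := E (Ordinal (isT : 2 < 4)%N); have := E (Ordinal (isT : 3 < 4)%N).
rewrite /gram_entry /= => E3 E2 E1 E0.
have [cE0 cE1 cE2 cE3] :
  [/\ conj (a * al + b * be + c * th + d * ta) = 0,
      conj (a * be + b * conj al + c * conj ta + d * conj th) = 0,
      conj (a * th + b * conj ta + c * ga + d * de) = 0 &
      conj (a * ta + b * conj th + c * de + d * conj ga) = 0].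
  by rewrite E0 E1 E2 E3 rmorph0.
rewrite ?(rmorphD, rmorphM) /= ?conjK cbe ?cde in cE0 cE1 cE2 cE3.
have deg x y : x * al + conj x * be + y * th + conj y * ta = 0 ->
    x * th + conj x * conj ta + y * ga + conj y * de = 0 ->
  forall x' y', bform al be th ta ga de x y x' y' = 0.
  move=> Ex Ey x' y'; pose ex := x * al + conj x * be + y * th + conj y * ta.
  pose ey := x * th + conj x * conj ta + y * ga + conj y * de.
  rewrite (_ : bform _ _ _ _ _ _ _ _ _ _ =
    x' * ex + conj x' * conj ex + y' * ey + conj y' * conj ey).
    by rewrite /ex /ey Ex Ey rmorph0 !mulr0 !addr0.
  rewrite /bform /trace /ex /ey ?(rmorphD, rmorphM) /= ?conjK cbe cde.
  by ring.
have [/andP[/eqP x0 /eqP y0]|nz] := boolP ((a + conj b == 0) && (c + conj d == 0)).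
  have [/andP[/eqP x1 /eqP y1]|nz] :=
      boolP ((i * (a - conj b) == 0) && (i * (c - conj d) == 0)).
    have zero2 s t : s + conj t = 0 -> i * (s - conj t) = 0 -> s = 0 /\ t = 0.
      move=> st0 /eqP; rewrite mulf_eq0 (negbTE i0) subr_eq0 => /eqP st.
      have s0 : s = 0.
        by apply/eqP; rewrite -(mulrI_eq0 _ (mulfI two0)) mulr_natl mulr2n {2}st st0.
      by split=> //; apply/eqP; rewrite -(fmorph_eq0 conj) -st s0.
    have [[a0 b0] [c0 d0]] := (zero2 _ _ x0 x1, zero2 _ _ y0 y1).
    case/negP: v0; apply/eqP/rowP => -[[|[|[|[|//]]]] lt_j]; rewrite mxE.
    - by rewrite -[RHS]a0; congr (v _ _); apply: val_inj.
    - by rewrite -[RHS]b0; congr (v _ _); apply: val_inj.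
    - by rewrite -[RHS]c0; congr (v _ _); apply: val_inj.
    by rewrite -[RHS]d0; congr (v _ _); apply: val_inj.
  exists (i * (a - conj b)), (i * (c - conj d)); split=> //.
  apply: deg; rewrite ?(rmorphD, rmorphB, rmorphN, rmorphM) /= ?conjK ci.
    have /eqP := congr1 (fun u => i * u) (etrans E0 (esym cE1)).
    by rewrite -subr_eq0 => /eqP <-; ring.
  have /eqP := congr1 (fun u => i * u) (etrans E2 (esym cE3)).
    by rewrite -subr_eq0 => /eqP <-; ring.
exists (a + conj b), (c + conj d); split=> //; apply: deg; rewrite !rmorphD /= !conjK.
  by have := congr2 +%R E0 cE1; rewrite addr0 => <-; ring.
by have := congr2 +%R E2 cE3; rewrite addr0 => <-; ring.
Qed.

End GramForm.

(** * Counting and linear functionals *)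

(** The only collisions of f are between x and -x. Applying g to one of the two, chosen by
    [enum_rank], separates them, and on a finite set injectivity is enough. *)
Lemma even_twist_bijective (V : finZmodType) (f g : V -> V) :
    (forall x y, f x = f y -> x = y \/ x = - y) -> injective g ->
    (forall x y, f x = g (f y) -> x = 0 /\ y = 0) ->
  exists2 h : V -> V, bijective h & forall x, h x = f x \/ h x = g (f x).
Proof.
move=> f_even g_inj fg.
pose half (x : V) := (enum_rank x <= enum_rank (- x))%N.
exists (fun x => if half x then f x else g (f x)); last first.
  by move=> x; case: ifP; [left | right].
apply: injF_bij => x y.
have eq_half : half x = half y -> x = - y -> x = y.
  move=> hxy xy; move: hxy; rewrite /half xy opprK => hxy.
  apply/enum_rank_inj/val_inj => /=; apply/eqP; rewrite eqn_leq.
  by move: hxy; case: ltngtP.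
case hx: (half x); case hy: (half y) => fxy.
- by have [//|] := f_even _ _ fxy; apply: eq_half; rewrite hx hy.
- by have [-> ->] := fg _ _ fxy.
- by have [-> ->] := fg _ _ (esym fxy).
by have [//|] := f_even _ _ (g_inj _ _ fxy); apply: eq_half; rewrite hx hy.
Qed.

Lemma card_fiber (V W : finZmodType) (f : V -> W) w :
    {morph f : x y / x + y} -> (forall y, exists x, f x = y) ->
  (#|[set v | f v == w]| * #|W| = #|V|)%N.
Proof.
move=> fD f_surj; rewrite -[RHS]sum1_card (partition_big f xpredT) //= mulnC.
rewrite -sum_nat_const; apply: eq_bigr => y _.
have [x fx] := f_surj (w - y).
rewrite -sum1_card (reindex_inj (addIr x)) /=.
apply: eq_bigl => v; rewrite inE fD fx /=.
by rewrite -[in RHS](inj_eq (addIr (w - y))) [y + _]addrC subrK.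
Qed.

Lemma pigeonhole_neq0 (V W : finZmodType) (f : V -> W) :
    {morph f : x y / x + y} -> (#|W| < #|V|)%N ->
  exists2 v, v != 0 & f v = 0.
Proof.
move=> fD ltWV.
have f0 : f 0 = 0 by apply: (addrI (f 0)); rewrite -fD !addr0.
have fN x : f (- x) = - f x by apply: (addrI (f x)); rewrite -fD !subrr.
have /injectivePn[x [y xy fxy]] : ~~ injectiveb f.
  by apply: contraL ltWV => /injectiveP/leq_card; rewrite -leqNgt.
by exists (x - y); rewrite ?subr_eq0 // fD fN fxy subrr.
Qed.

Lemma pigeonhole_notin (T V : finType) (f : T -> V) :
  (#|T| < #|V|)%N -> exists v, forall t, f t != v.
Proof.
move=> ltTV; have [v nv] : exists v, v \notin codom f.
  apply/existsP; rewrite -negb_forall; apply: contraL ltTV => /forallP all_f.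
  by rewrite -leqNgt -(eq_card all_f) leq_image_card.
by exists v => t; apply: contraNneq nv => <-; apply: codom_f.
Qed.

Lemma dual_vector (F : finFieldType) n (f g : 'rV[F]_n -> F) :
    scalar f -> scalar g ->
    (forall t, exists v, f v + t * g v != 0) -> (exists v, g v != 0) ->
  exists v, f v = 1 /\ g v = 0.
Proof.
move=> f_lin g_lin fg [w gw].
have fZ a v : f (a *: v) = a * f v.
  have f0 : f 0 = 0.
    have := f_lin 1 0 0; rewrite scale1r mul1r addr0 => /eqP.
    by rewrite -subr_eq subrr eq_sym => /eqP.
  by have := f_lin a v 0; rewrite f0 !addr0.
have gZ a v : g (a *: v) = a * g v.
  have g0 : g 0 = 0.
    have := g_lin 1 0 0; rewrite scale1r mul1r addr0 => /eqP.
    by rewrite -subr_eq subrr eq_sym => /eqP.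
  by have := g_lin a v 0; rewrite g0 !addr0.
have [u fu] := fg (- (f w / g w)).
pose v := - (g u / g w) *: w + u.
have gv : g v = 0 by rewrite g_lin mulNr divfK // addNr.
have fv : f v != 0.
  rewrite f_lin; apply: contraNneq fu => fv0; rewrite -fv0; apply/eqP; ring.
by exists ((f v)^-1 *: v); rewrite fZ gZ gv mulr0 mulVf.
Qed.

Lemma independent_functionals (F : finFieldType) n (f g : 'rV[F]_n -> F) :
    scalar f -> scalar g ->
    (forall s t, (s != 0) || (t != 0) -> exists v, s * f v + t * g v != 0) ->
  forall x y, exists v, f v = x /\ g v = y.
Proof.
move=> f_lin g_lin fg x y.
have one_or (s : F) : (1 != 0 :> F) || (s != 0) by rewrite oner_eq0.
have or_one (s : F) : (s != 0) || (1 != 0 :> F) by rewrite oner_eq0 orbT.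
have [||v1 [fv1 gv1]] := dual_vector f_lin g_lin.
- by move=> t; have [v] := fg 1 t (one_or t); rewrite mul1r; exists v.
- by have [v] := fg 0 1 (or_one 0); rewrite mul0r add0r mul1r; exists v.
have [||v2 [gv2 fv2]] := dual_vector g_lin f_lin.
- by move=> t; have [v] := fg t 1 (or_one t); rewrite mul1r addrC; exists v.
- by have [v] := fg 1 0 (one_or 0); rewrite mul0r addr0 mul1r; exists v.
exists (x *: v1 + (y *: v2 + 0)); rewrite !f_lin !g_lin fv1 fv2 gv1 gv2.
have f0 : f 0 = 0.
  by have := f_lin (-1) v1 v1; rewrite scaleN1r addNr mulN1r addNr.
have g0 : g 0 = 0.
  by have := g_lin (-1) v1 v1; rewrite scaleN1r addNr mulN1r addNr.
by rewrite f0 g0 !mulr0 !mulr1 !addr0 add0r.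
Qed.

Section DotProduct.

Variables (F : fieldType) (n : nat).
Implicit Types u v w : 'rV[F]_n.

Definition dot (u v : 'rV[F]_n) : F := (u *m v^T) 0 0.

Lemma dotC u v : dot u v = dot v u.
Proof. by rewrite /dot -[v *m _]trmxK trmx_mul trmxK [RHS]mxE. Qed.

Lemma dot_linear u : scalar (dot u).
Proof. by move=> a v w; rewrite /dot linearP /= mulmxDr -scalemxAr !mxE. Qed.

Lemma dotZ u a v : dot u (a *: v) = a * dot u v.
Proof. by rewrite /dot linearZ /= -scalemxAr mxE. Qed.

Lemma dotD u v w : dot u (v + w) = dot u v + dot u w.
Proof. by rewrite -[v]scale1r dot_linear mul1r scale1r. Qed.

Lemma dot_neq0 v : v != 0 -> exists u, dot u v != 0.
Proof.
move=> /rV0Pn[j vj]; exists (delta_mx 0 j).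
by rewrite /dot -rowE !mxE.
Qed.

End DotProduct.

(** * The web of a commutative presemifield *)

Section Presemifield.

Variable F : finFieldType.
Local Notation V := 'rV[F]_4.
Variable c : V -> V -> V.
Hypothesis cC : commutative c.
Hypothesis c_linear : forall u, linear (c u).
Hypothesis c_nzd : forall u v, c u v = 0 -> u = 0 \/ v = 0.

(** A web in the classical sense, a linear system of quadrics of projective dimension three: z is
    the parameter and (u, v) are the arguments of the symmetric form. *)
Definition web z u v := dot z (c u v).

Lemma webC z u v : web z u v = web z v u.
Proof. by rewrite /web cC. Qed.

Lemma web_linear z u : scalar (web z u).
Proof. by move=> a v w; rewrite /web c_linear dot_linear. Qed.

Lemma web_linear1 u v : scalar (fun z => web z u v).
Proof. by move=> a z z'; rewrite /web dotC dot_linear ![dot _ (c _ _)]dotC. Qed.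

Lemma webDz u v z z' : web (z + z') u v = web z u v + web z' u v.
Proof. by have := web_linear1 u v 1 z z'; rewrite scale1r mul1r. Qed.

Lemma webD z u v w : web z u (v + w) = web z u v + web z u w.
Proof. by have := web_linear z u 1 v w; rewrite scale1r mul1r. Qed.

Lemma web0 z u : web z u 0 = 0.
Proof. by apply: (addrI (web z u 0)); rewrite -webD !addr0. Qed.

Lemma web0l z v : web z 0 v = 0.
Proof. by rewrite webC web0. Qed.

Lemma web0z u v : web 0 u v = 0.
Proof. by apply: (addrI (web 0 u v)); rewrite -webDz !addr0. Qed.

Lemma webZ z u a v : web z u (a *: v) = a * web z u v.
Proof. by have := web_linear z u a v 0; rewrite !addr0 web0 addr0. Qed.

Lemma webZz u v a z : web (a *: z) u v = a * web z u v.
Proof. by have := web_linear1 u v a z 0; rewrite !addr0 web0z addr0. Qed.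

Lemma webDl z u u' v : web z (u + u') v = web z u v + web z u' v.
Proof. by rewrite webC webD !(webC z v). Qed.

Lemma webZl z u a v : web z (a *: u) v = a * web z u v.
Proof. by rewrite webC webZ webC. Qed.

Lemma webN z u v : web z u (- v) = - web z u v.
Proof. by rewrite -scaleN1r webZ mulN1r. Qed.

Lemma webNl z u v : web z (- u) v = - web z u v.
Proof. by rewrite webC webN webC. Qed.

Lemma webNz z u v : web (- z) u v = - web z u v.
Proof. by rewrite -scaleN1r webZz mulN1r. Qed.

Definition webE := (webD, webDl, webDz, webZ, webZl, webZz, webN, webNl, webNz).

Lemma web_neq0 z u : z != 0 -> u != 0 -> exists v, web z u v != 0.
Proof.
move=> z0 u0; have [w] := dot_neq0 z0; rewrite dotC.
have c_inj : injective (c u).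
  move=> v v' cvv'; apply/eqP; rewrite -subr_eq0; apply/eqP.
  have := c_linear u (-1) v' v; rewrite !scaleN1r cvv' addrC subrr addrC.
  by case/c_nzd => // u00; rewrite u00 eqxx in u0.
have [h _ hK] := injF_bij c_inj.
by exists (h w); rewrite /web hK.
Qed.

Lemma cDl u v w : c (u + v) w = c u w + c v w.
Proof. by rewrite cC -[u]scale1r c_linear !scale1r !(cC w). Qed.

Lemma cZl a u w : c (a *: u) w = a *: c u w.
Proof.
have c0 : c w 0 = 0.
  by have := c_linear w (-1) u u; rewrite !scaleN1r !addNr.
by rewrite cC -[a *: u]addr0 c_linear c0 addr0 cC.
Qed.

Lemma cNl u v : c (- u) v = - c u v.
Proof. by rewrite -scaleN1r cZl scaleN1r. Qed.

Lemma c0l v : c 0 v = 0.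
Proof. by rewrite -(scale0r v) cZl !scale0r. Qed.

Lemma c_square x y : c x x = c y y -> x = y \/ x = - y.
Proof.
move=> cxy; have : c (x - y) (x + y) = 0.
  rewrite cDl cNl !(cC _ (x + y)) !cDl cxy (cC y x).
  by rewrite [c x y + _]addrC subrr.
case/c_nzd => /eqP; first by rewrite subr_eq0 => /eqP; left.
by rewrite addr_eq0 => /eqP; right.
Qed.

Lemma common_zero (f g h : V -> F) :
    scalar f -> scalar g -> scalar h ->
  exists z, [/\ z != 0, f z = 0, g z = 0 & h z = 0].
Proof.
move=> f_lin g_lin h_lin.
pose k z : 'rV[F]_3 := \row_j nth 0 [:: f z; g z; h z] j.
have kD : {morph k : x y / x + y}.
  move=> x y; apply/rowP => j; rewrite !mxE -[x]scale1r f_lin g_lin h_lin.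
  by case: j => [[|[|[|]]] //= _]; rewrite !scale1r mul1r.
have [|z z0 /rowP kz] := pigeonhole_neq0 kD.
  by rewrite !card_mx !mul1n ltn_exp2l // finNzRing_gt1.
exists z; split=> //.
- by have := kz (Ordinal (isT : 0 < 3)%N); rewrite !mxE.
- by have := kz (Ordinal (isT : 1 < 3)%N); rewrite !mxE.
by have := kz (Ordinal (isT : 2 < 3)%N); rewrite !mxE.
Qed.

Lemma web_functional z1 z2 u : u != 0 ->
    (forall s t, (s != 0) || (t != 0) -> s *: z1 + t *: z2 != 0) ->
  forall x y, exists v, web z1 u v = x /\ web z2 u v = y.
Proof.
move=> u0 ind; apply: independent_functionals; try exact: web_linear.
move=> s t st; have [v] := web_neq0 (ind s t st) u0.
by rewrite !webE => nz; exists v.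
Qed.

Lemma web_functional2 z u1 u2 : z != 0 ->
    (forall s t, (s != 0) || (t != 0) -> s *: u1 + t *: u2 != 0) ->
  forall x y, exists v, web z u1 v = x /\ web z u2 v = y.
Proof.
move=> z0 ind; apply: independent_functionals; try exact: web_linear.
move=> s t st; have [v] := web_neq0 z0 (ind s t st).
by rewrite !webE => nz; exists v.
Qed.

Let q := #|F|.

Lemma card_V : #|{: V}| = (q ^ 4)%N.
Proof. by rewrite card_mx mul1n. Qed.

Definition independent (x0 x1 : V) :=
  forall s t : F, (s != 0) || (t != 0) -> s *: x0 + t *: x1 != 0.

Definition line_point (x0 x1 : V) (s : 'rV[F]_2) := s 0 0 *: x0 + s 0 1 *: x1.

Lemma line_pointD x0 x1 : {morph line_point x0 x1 : s t / s + t}.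
Proof. by move=> s t; rewrite /line_point !mxE !scalerDl addrACA. Qed.

Lemma row2E (s t : 'rV[F]_2) : s 0 0 = t 0 0 -> s 0 1 = t 0 1 -> s = t.
Proof.
move=> e0 e1; apply/rowP => -[[|[|//]] lt_j].
  by rewrite (_ : Ordinal _ = 0) ?e0 //; apply: val_inj.
by rewrite (_ : Ordinal _ = 1) ?e1 //; apply: val_inj.
Qed.

Lemma line_point_inj x0 x1 : independent x0 x1 -> injective (line_point x0 x1).
Proof.
move=> ind s t st; apply/eqP; rewrite -subr_eq0; apply/eqP.
have lp0 : line_point x0 x1 (s - t) = 0.
  by apply: (addIr (line_point x0 x1 t)); rewrite -line_pointD subrK add0r.
have [nz|] := boolP (((s - t) 0 0 != 0) || ((s - t) 0 1 != 0)).
  by have := ind _ _ nz; rewrite -/(line_point x0 x1 (s - t)) lp0 eqxx.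
rewrite negb_or !negbK => /andP[/eqP e0 /eqP e1].
by apply: row2E; rewrite ?e0 ?e1 mxE.
Qed.

Lemma card_row2 : #|{: 'rV[F]_2}| = (q ^ 2)%N.
Proof. by rewrite card_mx. Qed.

Lemma q_gt1 : (1 < q)%N.
Proof. exact: finNzRing_gt1. Qed.

Lemma plane_kernel (f g : V -> F) x0 x1 : scalar f -> scalar g ->
    (forall x y, exists v, f v = x /\ g v = y) -> independent x0 x1 ->
    f x0 = 0 -> f x1 = 0 -> g x0 = 0 -> g x1 = 0 ->
  [set v | (f v == 0) && (g v == 0)] = line_point x0 x1 @: setT.
Proof.
move=> f_lin g_lin fg ind fx0 fx1 gx0 gx1.
have f0 : f 0 = 0.
  by have := f_lin (-1) x0 x0; rewrite scaleN1r addNr mulN1r addNr.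
have g0 : g 0 = 0.
  by have := g_lin (-1) x0 x0; rewrite scaleN1r addNr mulN1r addNr.
pose k v : 'rV[F]_2 := \row_j if j == 0 then f v else g v.
have -> : [set v | (f v == 0) && (g v == 0)] = [set v | k v == 0%R].
  apply/setP => v; rewrite !inE; apply/andP/eqP => [[/eqP fv /eqP gv]|kv].
    by apply: row2E; rewrite !mxE /= ?fv ?gv.
  have := congr1 (fun s : 'rV[F]_2 => s 0 0) kv; have := congr1 (fun s : 'rV[F]_2 => s 0 1) kv.
  by rewrite !mxE /= => -> ->.
have cardK : (#|[set v | k v == 0%R]| * q ^ 2 = q ^ 4)%N.
  rewrite -card_row2 -card_V; apply: card_fiber.
    move=> x y; apply/rowP => j; rewrite !mxE -[x]scale1r f_lin g_lin.
    by rewrite !scale1r !mul1r; case: ifP.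
  move=> y; have [v [v0 v1]] := fg (y 0 0) (y 0 1).
  by exists v; apply: row2E; rewrite mxE.
have {}cardK : #|[set v | k v == 0%R]| = (q ^ 2)%N.
  apply/eqP; rewrite -(eqn_pmul2r (_ : 0 < q ^ 2)%N) ?expn_gt0 ?(ltnW q_gt1) //.
  by rewrite cardK -expnD.
apply/eqP; rewrite eq_sym eqEcard cardK card_imset; last exact: line_point_inj.
rewrite cardsT card_row2 leqnn andbT; apply/subsetP => _ /imsetP[s _ ->].
rewrite inE; apply/eqP; apply: row2E; rewrite !mxE /= /line_point.
  by rewrite f_lin -[_ *: x1]addr0 f_lin fx0 fx1 f0 !mulr0 !addr0.
by rewrite g_lin -[_ *: x1]addr0 g_lin gx0 gx1 g0 !mulr0 !addr0.
Qed.

(* Otherwise x |-> c x x could be corrected, by factors lam, to a bijection of V,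
   and every quadratic form z would have q^3 zeros; but there is a nonzero z
   vanishing on a 2-dimensional subspace, and it has q^3 + q^2 - q of them. *)
Lemma exists_special lam : (forall x : F, x ^+ 2 != lam) -> 2 != 0 :> F ->
  exists x y, [/\ x != 0, y != 0 & c y y = lam *: c x x].
Proof.
move=> lam_ns two0.
have lam0 : lam != 0 by have := lam_ns 0; rewrite expr0n /= eq_sym.
case: (boolP [exists x, [exists y,
    [&& x != 0, y != 0 & c y y == lam *: c x x]]]) => [|none].
  by case/existsP=> x /existsP[y /and3P[x0 y0 /eqP exy]]; exists x, y.
exfalso.
have [||h h_bij hE] := @even_twist_bijective _ (fun x => c x x) (fun x => lam *: x) c_square.
- exact: scalerI.
- move=> x y /= cxy; have [y0|y0] := eqVneq y 0.
    by move: cxy; rewrite y0 c0l scaler0 => /c_nzd; case.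
  have [x0|x0] := eqVneq x 0.
    move/esym/eqP: cxy; rewrite x0 c0l scaler_eq0 (negbTE lam0) => /eqP/c_nzd.
    by case=> y00; rewrite y00 eqxx in y0.
  case/negP: none; apply/existsP; exists y; apply/existsP; exists x.
  by rewrite x0 y0 cxy eqxx.
have [x0 x00] : exists x0 : V, x0 != 0.
  by exists (delta_mx 0 0); apply/rV0Pn; exists 0; rewrite mxE oner_eq0.
have [x1 x01] : exists x1 : V, forall t, t *: x0 != x1.
  apply: pigeonhole_notin; rewrite card_V -{1}[#|_|]expn1 ltn_exp2l //.
  exact: finNzRing_gt1.
have ind : independent x0 x1.
  move=> s t; apply: contraTneq => /eqP; rewrite addr_eq0 => /eqP e.
  have t0 : t = 0.
    apply/eqP; apply: contraT => t0; have := x01 (- (t^-1 * s)).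
    by rewrite scaleNr -scalerA e scalerN scalerA mulVf // scale1r opprK eqxx.
  move/eqP: e; rewrite t0 scale0r oppr0 scaler_eq0 (negbTE x00) orbF.
  by move=> /eqP->; rewrite eqxx.
have [z [z0 z00 z01 z11]] :=
  common_zero (web_linear1 x0 x0) (web_linear1 x0 x1) (web_linear1 x1 x1).
pose P := [set x | web z x x == 0].
(* As h x is c x x or lam times it, the zeros of the quadratic form z are the preimage under the
   bijection h of the hyperplane orthogonal to z. *)
have cardP : (#|P| * q = q ^ 4)%N.
  have -> : P = h @^-1: [set v | dot z v == 0].
    apply/setP=> x; rewrite !inE; have [->//|->] := hE x.
    by rewrite dotZ mulf_eq0 (negbTE lam0).
  rewrite on_card_preimset; last by apply: onW_bij.
  rewrite -card_V; apply: card_fiber.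
    by move=> x y; rewrite -[x]scale1r dot_linear mul1r scale1r.
  move=> y; have [v] := dot_neq0 z0; rewrite dotC => dv.
  by exists ((y / dot z v) *: v); rewrite dotZ divfK.
pose ln := line_point x0 x1.
have Qln s : web z (ln s) (ln s) = 0.
  by rewrite /ln /line_point !webE z00 (webC z x1) z01 z11; ring.
pose K := [set v | (web z x0 v == 0) && (web z x1 v == 0)].
have KE : K = ln @: setT.
  apply: plane_kernel => //; try exact: web_linear.
    exact: web_functional2.
  by rewrite webC.
have cardK : #|K| = (q ^ 2)%N.
  by rewrite KE card_imset ?cardsT ?card_row2 //; apply: line_point_inj.
(* The pairs (v, s) with v + ln s a zero are counted in two ways. On the coset of v the form is
   affine in s: identically zero if v is in K, which is the isotropic plane itself, and nonconstant
   with q zeros otherwise. *)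
pose T v := [set s | web z (v + ln s) (v + ln s) == 0].
have TK v : v \in K -> #|T v| = (q ^ 2)%N.
  rewrite KE => /imsetP[s _ ->]; rewrite -card_row2.
  by apply: eq_card => t; rewrite !inE -line_pointD Qln eqxx.
have TnK v : v \notin K -> #|T v| = q.
  rewrite inE => nK; pose f s := web z (v + ln s) (v + ln s) - web z v v.
  have fE s : f s = 2 * (s 0 0 * web z x0 v + s 0 1 * web z x1 v).
    have expand l : web z (v + l) (v + l) - web z v v = 2 * web z l v + web z l l.
      by rewrite !webE (webC z v l); ring.
    by rewrite /f expand Qln /ln /line_point !webE addr0.
  have -> : T v = [set s | f s == - web z v v].
    by apply/setP => s; rewrite !inE -addr_eq0 subrK.
  apply/eqP; rewrite -(eqn_pmul2r (ltnW q_gt1)); apply/eqP.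
  rewrite card_fiber ?card_row2 // => [s t|y].
    by rewrite !fE !mxE; ring.
  case/nandP: nK => nz.
    exists (\row_j if j == 0 then y / 2 / web z x0 v else 0).
    by rewrite fE !mxE /=; field; rewrite nz two0.
  exists (\row_j if j == 0 then 0 else y / 2 / web z x1 v).
  by rewrite fE !mxE /=; field; rewrite nz two0.
have : (\sum_v #|T v| = q ^ 2 * #|P|)%N.
  under eq_bigr do rewrite -sum1_card big_mkcond /=.
  rewrite exchange_big /= -card_row2 -sum_nat_const.
  apply: eq_bigr => s _; rewrite -big_mkcond /= -sum1_card [RHS](reindex_inj (addIr (ln s))).
  by apply: eq_bigl => v; rewrite !inE.
rewrite (bigID (mem K)) /= (eq_bigr _ TK) sum_nat_const cardK.
rewrite (eq_bigr (fun=> q)) => [|v /TnK//]; rewrite sum_nat_const.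
have -> : #|[pred v | v \notin K]| = (q ^ 4 - q ^ 2)%N.
  by rewrite -card_V -cardK -(cardC K) addKn; apply: eq_card.
move=> /(congr1 (fun n => n * q)%N); rewrite -[RHS]mulnA cardP mulnDl.
have -> : (q ^ 2 * q ^ 2 * q = q ^ 5)%N by rewrite -expnD -expnSr.
have -> : ((q ^ 4 - q ^ 2) * q * q = q ^ 6 - q ^ 4)%N.
  by rewrite -mulnA mulnBl mulnn -!expnD.
rewrite -expnD => e.
have : (q ^ 5 == q ^ 4)%N.
  by rewrite -(eqn_add2r (q ^ 6 - q ^ 4)) e subnKC // leq_exp2l ?q_gt1.
by rewrite eqn_exp2l ?q_gt1.
Qed.

(** The values x^2 and lam y^2 agree only at 0, so [even_twist_bijective] makes a bijection of F out
    of them. *)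
Lemma square_or_twisted (lam d : F) : (forall x : F, x ^+ 2 != lam) ->
  (exists x, d = x ^+ 2) \/ (exists x, d = lam * x ^+ 2).
Proof.
move=> lam_ns.
have lam0 : lam != 0 by have := lam_ns 0; rewrite expr0n /= eq_sym.
have [|||h [h' hK h'K] hE] :=
    @even_twist_bijective F (fun x => x ^+ 2) (fun x => lam * x).
- by move=> x y /eqP; rewrite eqf_sqr => /orP[]/eqP; [left | right].
- exact: mulfI.
- move=> x y /= xy; have [y0|y0] := eqVneq y 0.
    by move/eqP: xy; rewrite y0 expr0n mulr0 sqrf_eq0 => /eqP.
  have := lam_ns (x / y).
  by rewrite expr_div_n xy mulfK ?expf_neq0 // eqxx.
by have := hE (h' d); rewrite h'K; case=> ->; [left | right]; exists (h' d).
Qed.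

Lemma independent_change x y (a b : F) : independent x y -> a != 0 ->
  independent x (a *: y + b *: x).
Proof.
move=> ind a0 s t st.
have -> : s *: x + t *: (a *: y + b *: x) = (s + t * b) *: x + (t * a) *: y.
  by rewrite scalerDl scalerDr !scalerA -!addrA [_ *: x + _ *: y]addrC.
apply: ind; rewrite mulf_eq0 (negbTE a0) orbF.
have [t0|t0] := eqVneq t 0; last by rewrite orbT.
by move: st; rewrite t0 mul0r addr0 eqxx !orbF.
Qed.

Lemma special_pencil lam : (forall x : F, x ^+ 2 != lam) -> 2 != 0 :> F ->
  exists u0 u1 z1 z2, [/\ independent u0 u1, independent z1 z2,
    forall v, web z1 u1 v = web z2 u0 v,
    forall v, web z2 u1 v = lam * web z1 u0 v &
    [/\ web z1 u0 u0 = 0, web z1 u0 u1 = 0, web z2 u0 u0 = 0 &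
        web z2 u0 u1 = 0]].
Proof.
move=> lam_ns two0; have [u0 [y [u00 y0 cyy]]] := exists_special lam_ns two0.
have indE x x' : x != 0 -> (forall t, t *: x != x') -> independent x x'.
  move=> x0 xx' s t; apply: contraTneq => /eqP; rewrite addr_eq0 => /eqP e.
  have t0 : t = 0.
    apply/eqP; apply: contraT => t0; have := xx' (- (t^-1 * s)).
    by rewrite scaleNr -scalerA e scalerN scalerA mulVf // scale1r opprK eqxx.
  move/eqP: e; rewrite t0 scale0r oppr0 scaler_eq0 (negbTE x0) orbF.
  by move=> /eqP->; rewrite eqxx.
have indy : independent u0 y.
  apply: indE => // t; apply/eqP => yt; have := lam_ns t.
  move: cyy; rewrite -yt cZl cC cZl scalerA => /eqP.
  rewrite -subr_eq0 -scalerBl scaler_eq0 subr_eq0 -expr2 => /orP[/eqP->|/eqP].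
    by rewrite eqxx.
  by case/c_nzd => e; rewrite e eqxx in u00.
(* Two conditions suffice, as web z y y = lam web z u0 u0; the third slot of [common_zero] is filled
   by a repetition. For w it holds the coordinate k, which makes w independent of z1. *)
have [z1 [z10 z1u z1y _]] :=
  common_zero (web_linear1 u0 u0) (web_linear1 u0 y) (web_linear1 u0 y).
have [k z1k] := rV0Pn _ z10.
have coord_lin : scalar (fun z : V => z 0 k) by move=> a v v'; rewrite !mxE.
have [w [w0 wu wy wk]] :=
  common_zero (web_linear1 u0 u0) (web_linear1 u0 y) coord_lin.
have indw : independent z1 w.
  move=> s t; apply: contraTneq => e.
  have := congr1 (fun v : V => v 0 k) e; rewrite !mxE wk mulr0 addr0 => /eqP.
  rewrite mulf_eq0 (negbTE z1k) orbF => /eqP s0; move/eqP: e.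
  by rewrite s0 scale0r add0r scaler_eq0 (negbTE w0) orbF => /eqP->; rewrite eqxx.
have yy z : web z u0 u0 = 0 -> web z y y = 0.
  by rewrite /web cyy dotZ => ->; rewrite mulr0.
have fg := web_functional u00 indw.
have KE := plane_kernel (web_linear z1 u0) (web_linear w u0) fg indy z1u z1y wu wy.
have [v0 [z1v0 wv0]] := fg 1 0; have [v1 [z1v1 wv1]] := fg 0 1.
(* The functional web z y vanishes on <u0, y>, the common kernel of web z1 u0 and web w u0, and is
   therefore a combination of these two. *)
have span z : web z u0 u0 = 0 -> web z u0 y = 0 -> forall v,
    web z y v = web z y v0 * web z1 u0 v + web z y v1 * web w u0 v.
  move=> zu zy v; pose v' := v - web z1 u0 v *: v0 - web w u0 v *: v1.
  have : v' \in [set v | (web z1 u0 v == 0) && (web w u0 v == 0)].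
    by rewrite inE /v' !webE z1v0 z1v1 wv0 wv1; apply/andP; split; apply/eqP; ring.
  rewrite KE => /imsetP[s _ v'E].
  have : web z y v' = 0.
    by rewrite v'E /line_point !webE (webC z y) zy yy // !mulr0 addr0.
  by rewrite /v' !webE => /eqP; rewrite -addrA -opprD subr_eq0 => /eqP->; ring.
have span1 := span z1 z1u z1y; have spanw := span w wu wy.
set p := web z1 y v0 in span1; set r := web z1 y v1 in span1.
set s := web w y v0 in spanw; set t := web w y v1 in spanw.
have r0 : r != 0.
  apply/eqP => r0; have := indy (- p) 1; rewrite oner_eq0 orbT => /(_ isT) nz.
  have [v] := web_neq0 z10 nz.
  by rewrite !webE span1 r0 mul0r addr0 mulNr mul1r addNr eqxx.
(* The rows (p, r) and (s, t) form the matrix of the operator comparing y with u0. Replacing y by (y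
   - p u0) / r turns the rows into (0, 1) and (s / r, 2 h); shifting y and w by h then removes the
   trace and leaves (0, 1) and (d, 0). *)
pose h := ((t - p) / r) / 2; pose d := s / r + h ^+ 2.
pose y2 := r^-1 *: y + (- (p / r) - h) *: u0; pose w2 := 1 *: w + (- h) *: z1.
have indy2 : independent u0 y2 by apply: independent_change; rewrite ?invr_eq0.
have indw2 : independent z1 w2 by apply: independent_change; rewrite ?oner_eq0.
have zyE v : web z1 y2 v = web w2 u0 v.
  by rewrite /y2 /w2 !webE span1; field.
have wyE v : web w2 y2 v = d * web z1 u0 v.
  by rewrite /y2 /w2 !webE span1 spanw /d /h; field; rewrite r0 two0.
have zy2 : web z1 u0 y2 = 0 by rewrite /y2 !webE z1u z1y !mulr0 addr0.
have wu2 : web w2 u0 u0 = 0 by rewrite /w2 !webE z1u wu !mulr0 addr0.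
have wy2 : web w2 u0 y2 = 0 by rewrite /w2 /y2 !webE z1u z1y wu wy !mulr0 !addr0.
(* For d = e^2 the form w2 - e z1 would have y2 + e u0 in its radical. *)
have d_ns e : d != e ^+ 2.
  apply/eqP => de.
  have e1 (x : F) : (x != 0) || (1 != 0 :> F) by rewrite oner_eq0 orbT.
  have [v] := web_neq0 (indw2 (- e) 1 (e1 _)) (indy2 e 1 (e1 _)).
  have expand (z z' x x' : V) : web (- e *: z + 1 *: z') (e *: x + 1 *: x') v =
      web z' x' v + e * web z' x v - e * web z x' v - e ^+ 2 * web z x v.
    by rewrite !webE; ring.
  by rewrite expand wyE zyE de => /eqP[]; ring.
have [[e de]|[e de]] := square_or_twisted d lam_ns.
  by have := d_ns e; rewrite de eqxx.
have e0 : e^-1 != 0.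
  by rewrite invr_eq0; apply: contraNneq (d_ns 0) => e0; rewrite de e0 expr0n mulr0.
exists u0, (e^-1 *: y2 + 0 *: u0), z1, (e^-1 *: w2 + 0 *: z1).
split; try exact: independent_change.
- by move=> v; rewrite !scale0r !addr0 !(webZl, webZz) zyE.
- move=> v; rewrite !scale0r !addr0 !(webZl, webZz) wyE de.
  by rewrite invr_eq0 in e0; field.
by rewrite !scale0r !addr0 !(webZ, webZz) zy2 wu2 wy2 !mulr0 z1u.
Qed.

(** * Normal forms *)

Section Frames.

Variables (L : fieldExtType F) (conj : {lrmorphism L -> L}) (i : L) (lam : F).
Hypothesis conj_i : conj i = - i.
Hypothesis i2 : i ^+ 2 = lam%:A.
Hypothesis span_i : forall x : L, exists a b : F, x = a%:A + b%:A * i.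
Hypothesis lam_ns : forall x, x ^+ 2 != lam.
Hypothesis two_neq0 : 2 != 0 :> F.

Let two_neq0L : 2 != 0 :> L := ext_two_neq0 L two_neq0.
Let i0 : i != 0 := ext_i_neq0 i2 lam_ns.
Let conjK : involutive conj := conjK conj_i span_i.

Definition frame (X Y : V -> L) :=
  [/\ linear X, linear Y, forall v, X v = 0 -> Y v = 0 -> v = 0 &
      forall x y, exists v, X v = x /\ Y v = y].

Lemma algM (x y : F) : (x * y)%:A = x%:A * y%:A :> L.
Proof. by rewrite mulr_algl scalerA. Qed.

Lemma linear_pair (f g : V -> F) : scalar f -> scalar g ->
  linear (fun v => (f v)%:A + (g v)%:A * i).
Proof.
move=> f_lin g_lin a v w; rewrite f_lin g_lin !scalerDl -!scalerA mulrDl scalerDr.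
by rewrite -scalerAl addrACA.
Qed.

Definition has_form (X Y : V -> L) z al be th ta ga de := forall u v,
  (web z u v)%:A = bform conj al be th ta ga de (X u) (Y u) (X v) (Y v).

Lemma bform_pencil th x y x' y' (kap : bool) :
  bform conj 0 0 th 0 (conj th *+ kap) 0 x y x' y' =
  trace conj (th * (x * y' + x' * y + conj (y * y') *+ kap)).
Proof.
rewrite /bform /trace; case: kap; rewrite ?mulr1n ?mulr0n.
  by rewrite ?(rmorphD, rmorphM, rmorph0) /= ?conjK; ring.
by rewrite ?(rmorphD, rmorphM, rmorph0) /= ?conjK; ring.
Qed.

(** The L-valued form Psi = z2 + z1 i satisfies Psi (u0, v) = Y v and Psi (u1, v) = i Y v. Hence
    subtracting X0 u Y v + X0 v Y u leaves a form E in Y u and Y v alone. A change of X absorbs its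
    terms in Y Y' and Y Y'^ + Y^ Y', but not the one in (Y Y')^, which is the origin of kap. *)
Lemma pencil_frame : exists X Y (kap : bool) z1 z2,
  [/\ frame X Y, independent z1 z2 & exists T : F -> F -> L,
    [/\ T 0 0 = 0, forall th, exists s t, T s t = th &
      forall s t, has_form X Y (s *: z1 + t *: z2)
        0 0 (T s t) 0 (conj (T s t) *+ kap) 0]].
Proof.
have four_neq0 : 4 != 0 :> L by rewrite (_ : 4 = 2 * 2) ?mulf_neq0 //; ring.
have [u0 [u1 [z1 [z2 [indu indz zu1 zu2 [z100 z101 z200 z201]]]]]] :=
  special_pencil lam_ns two_neq0.
have lam0 : lam != 0 by have := lam_ns 0; rewrite expr0n /= eq_sym.
have u00 : u0 != 0.
  by have := indu 1 0; rewrite oner_eq0 scale1r scale0r addr0 => ->.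
have fg := web_functional u00 indz.
have [v0 [z1v0 z2v0]] := fg 0 1; have [v1 [z1v1 z2v1]] := fg 1 0.
have KE := plane_kernel (web_linear z1 u0) (web_linear z2 u0) fg indu z100 z101 z200 z201.
have dot_fg : forall x y, exists w, dot w u0 = x /\ dot w u1 = y.
  apply: independent_functionals; try by move=> a v w; rewrite !(dotC _ u0, dotC _ u1) dot_linear.
  by move=> s t /indu /dot_neq0[w]; rewrite dotD !dotZ; exists w.
have [w0 [w0u0 w0u1]] := dot_fg 1 0; have [w1 [w1u0 w1u1]] := dot_fg 0 1.
pose Y v := (web z2 u0 v)%:A + (web z1 u0 v)%:A * i.
pose X0 v := (dot w0 v)%:A + (dot w1 v)%:A * i.
pose Psi u v := (web z2 u v)%:A + (web z1 u v)%:A * i.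
have Y_lin : linear Y by apply: linear_pair; apply: web_linear.
have X0_lin : linear X0 by apply: linear_pair; apply: dot_linear.
have Psi_lin u : linear (Psi u) by apply: linear_pair; apply: web_linear.
pose E u v := Psi u v - X0 u * Y v - X0 v * Y u.
have YE a v w : Y (a *: v + w) = a%:A * Y v + Y w by rewrite Y_lin mulr_algl.
have X0E a v w : X0 (a *: v + w) = a%:A * X0 v + X0 w by rewrite X0_lin mulr_algl.
have PE u a v w : Psi u (a *: v + w) = a%:A * Psi u v + Psi u w.
  by rewrite Psi_lin mulr_algl.
have E_C u v : E u v = E v u by rewrite /E /Psi !(webC _ u v); ring.
have E_lin a u u' v : E (a *: u + u') v = a%:A * E u v + E u' v.
  by rewrite E_C (E_C u) (E_C u') /E PE X0E YE; ring.
have X0u0 : X0 u0 = 1 by rewrite /X0 w0u0 w1u0 scale0r scale1r mul0r addr0.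
have X0u1 : X0 u1 = i by rewrite /X0 w0u1 w1u1 scale0r scale1r mul1r add0r.
have Yu0 : Y u0 = 0 by rewrite /Y z100 z200 scale0r mul0r addr0.
have Yu1 : Y u1 = 0 by rewrite /Y z101 z201 scale0r mul0r addr0.
have Eu0 v : E u0 v = 0 by rewrite /E X0u0 Yu0 mul1r mulr0 subr0 subrr.
have Eu1 v : E u1 v = 0.
  rewrite /E X0u1 Yu1 mulr0 subr0 /Psi zu2 zu1 /Y -scalerA -[lam *: _]mulr_algl.
  by rewrite -i2; ring.
have EU s v : E (line_point u0 u1 s) v = 0.
  have E0 : E 0 v = 0 by have := E_lin (-1) u0 u0 v; rewrite scaleN1r addNr Eu0 mulr0 addr0.
  by rewrite /line_point E_lin -[_ *: u1]addr0 E_lin Eu0 Eu1 E0 !mulr0 !addr0.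
have dec v : exists s, v = web z2 u0 v *: v0 + (web z1 u0 v *: v1 + line_point u0 u1 s).
  pose v' := v - web z2 u0 v *: v0 - web z1 u0 v *: v1.
  have : v' \in [set v | (web z1 u0 v == 0) && (web z2 u0 v == 0)].
    by rewrite inE /v' !webE z1v0 z1v1 z2v0 z2v1; apply/andP; split; apply/eqP; ring.
  rewrite KE => /imsetP[s _ v'E]; exists s; rewrite -v'E /v'.
  by rewrite (addrC (_ *: v1)) subrK addrC subrK.
pose re_ v := (Y v + conj (Y v)) / 2; pose im_ v := (Y v - conj (Y v)) / (2 * i).
have cY v : conj (Y v) = (web z2 u0 v)%:A - (web z1 u0 v)%:A * i.
  by rewrite /Y rmorphD rmorphM /= !rmorph_alg conj_i mulrN.
have reE v : (web z2 u0 v)%:A = re_ v by rewrite /re_ cY /Y; field.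
have imE v : (web z1 u0 v)%:A = im_ v by rewrite /im_ cY /Y; field; rewrite i0.
have EE v w : E v w = re_ v * re_ w * E v0 v0 +
    (re_ v * im_ w + im_ v * re_ w) * E v0 v1 + im_ v * im_ w * E v1 v1.
  have Ev x : E v x = re_ v * E v0 x + im_ v * E v1 x.
    have [s vE] := dec v; rewrite [in LHS]vE E_lin E_lin EU addr0.
    by rewrite reE imE.
  have Ew x : E w x = re_ w * E v0 x + im_ w * E v1 x.
    have [s wE] := dec w; rewrite [in LHS]wE E_lin E_lin EU addr0.
    by rewrite reE imE.
  by rewrite Ev (E_C v0 w) (E_C v1 w) !Ew (E_C v1 v0); ring.
(* The coefficients p, q0, r of E at Y Y', at Y Y'^ + Y^ Y' and at (Y Y')^. *)
pose p := E v0 v0 / 4 + E v0 v1 / (2 * i) + E v1 v1 / (4 * i ^+ 2).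
pose q0 := E v0 v0 / 4 - E v1 v1 / (4 * i ^+ 2).
pose r := E v0 v0 / 4 - E v0 v1 / (2 * i) + E v1 v1 / (4 * i ^+ 2).
pose X v := X0 v + p / 2 * Y v + q0 * conj (Y v).
have PsiE u v : Psi u v = X u * Y v + X v * Y u + r * conj (Y u * Y v).
  have -> : Psi u v = E u v + X0 u * Y v + X0 v * Y u by rewrite /E; ring.
  rewrite EE /X /p /q0 /r /re_ /im_ rmorphM /=.
  by field; rewrite ?i0 ?two_neq0L ?four_neq0.
pose rho := if r == 0 then 1 else r.
have rho0 : rho != 0 by rewrite /rho; case: (eqVneq r 0) => // _; apply: oner_neq0.
have PsiE' u v : Psi u v =
    rho * (X u / rho * Y v + X v / rho * Y u + conj (Y u * Y v) *+ (r != 0)).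
  rewrite PsiE /rho; case: (eqVneq r 0) => [->|r0] /=; rewrite ?mulr0n ?mulr1n.
    by rewrite !divr1 mul1r mul0r.
  by field.
have XE a v w : X (a *: v + w) = a%:A * X v + X w.
  by rewrite /X X0E YE rmorphD rmorphM /= rmorph_alg; ring.
exists (fun v => X v / rho), Y, (r != 0), z1, z2; split=> //.
  split=> //.
  - by move=> a v w; rewrite XE mulrDl -mulrA mulr_algl.
  - move=> v /eqP; rewrite mulf_eq0 invr_eq0 (negbTE rho0) orbF => /eqP Xv Yv.
    have [s vE] := dec v; have [y0 y1] := alg_i_eq0 conj_i i2 lam_ns two_neq0 Yv.
    move: Xv; rewrite /X Yv rmorph0 !mulr0 !addr0 vE y0 y1 !scale0r !add0r.
    rewrite /line_point X0E -[_ *: u1]addr0 X0E X0u0 X0u1.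
    rewrite [X0 0](_ : _ = 0); last by have := X0E (-1) u0 u0; rewrite scaleN1r addNr scaleN1r mulN1r addNr.
    rewrite mulr1 !addr0 => /(alg_i_eq0 conj_i i2 lam_ns two_neq0)[-> ->].
    by rewrite !scale0r addr0.
  move=> x y; have [c0 [c1 yE]] := span_i y.
  have [v' Yv'] : exists v', Y v' = y.
    exists (c0 *: v0 + (c1 *: v1 + 0)).
    have Y0 : Y 0 = 0 by have := YE (-1) u0 u0; rewrite scaleN1r addNr scaleN1r mulN1r addNr.
    have Yv0 : Y v0 = 1 by rewrite /Y z1v0 z2v0 scale1r scale0r mul0r addr0.
    have Yv1 : Y v1 = i by rewrite /Y z1v1 z2v1 scale1r scale0r mul1r add0r.
    by rewrite !YE Yv0 Yv1 Y0 yE; ring.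
  have [a [b xE]] := span_i (rho * x - p / 2 * y - q0 * conj y - X0 v').
  exists (a *: u0 + (b *: u1 + v')).
  have Yv : Y (a *: u0 + (b *: u1 + v')) = y.
    by rewrite !YE Yu0 Yu1 Yv' !mulr0 !add0r.
  split=> //; rewrite /X Yv !X0E X0u0 X0u1 mulr1 addrA -xE.
  by field; rewrite ?rho0 ?two_neq0L.
(* The trace of (a + b i) (z2 + z1 i) is 2 a z2 + 2 lam b z1, so a = t / 2 and b = s / (2 lam) yield
   s z1 + t z2. *)
exists (fun s t => rho * ((t / 2)%:A + (s / (2 * lam))%:A * i)).
split=> [|th|s t u v]; first by rewrite !mul0r !scale0r mul0r addr0 mulr0.
  have [a [b thE]] := span_i (th / rho); exists (2 * lam * b), (2 * a).
  rewrite mulrC [2 * a]mulrC mulfK // [2 * lam * b]mulrC mulfK ?mulf_neq0 //.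
  by rewrite -thE divfK.
set a := t / 2; set b := s / (2 * lam); set th := rho * _.
have {1}-> : s = 2 * lam * b by rewrite /b; field; rewrite lam0 two_neq0.
have {1}-> : t = 2 * a by rewrite /a; field.
have thE : th / rho = a%:A + b%:A * i by rewrite /th mulrC mulKf.
rewrite !webE.
have -> : bform conj 0 0 th 0 (conj th *+ (r != 0)) 0 (X u / rho) (Y u) (X v / rho) (Y v)
    = trace conj (th / rho * Psi u v).
  by rewrite PsiE' mulrA divfK // bform_pencil.
rewrite thE /Psi /trace ?(rmorphD, rmorphM) /= !rmorph_alg conj_i.
rewrite scalerDl !algM -i2 (_ : 2%:A = 2 :> L); last by rewrite scaler_nat.
by ring.
Qed.

Lemma form_expand X Y z : frame X Y -> exists al be th ta ga de,
  [/\ conj be = be, conj de = de & has_form X Y z al be th ta ga de].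
Proof.
move=> [X_lin Y_lin XY_inj XY_surj].
have four_neq0 : 4 != 0 :> L by rewrite (_ : 4 = 2 * 2) ?mulf_neq0 //; ring.
have XE a v w : X (a *: v + w) = a%:A * X v + X w by rewrite X_lin mulr_algl.
have YE a v w : Y (a *: v + w) = a%:A * Y v + Y w by rewrite Y_lin mulr_algl.
have [a0 [Xa0 Ya0]] := XY_surj 1 0; have [a1 [Xa1 Ya1]] := XY_surj i 0.
have [b0 [Xb0 Yb0]] := XY_surj 0 1; have [b1 [Xb1 Yb1]] := XY_surj 0 i.
pose re_ (x : L) := (x + conj x) / 2; pose im_ (x : L) := (x - conj x) / (2 * i).
have reE (a b : F) : re_ (a%:A + b%:A * i) = a%:A.
  by rewrite /re_ rmorphD rmorphM /= !rmorph_alg conj_i; field.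
have imE (a b : F) : im_ (a%:A + b%:A * i) = b%:A.
  by rewrite /im_ rmorphD rmorphM /= !rmorph_alg conj_i; field; rewrite i0.
have X0 : X 0 = 0 by have := XE (-1) a0 a0; rewrite scaleN1r addNr scaleN1r mulN1r addNr.
have Y0 : Y 0 = 0 by have := YE (-1) a0 a0; rewrite scaleN1r addNr scaleN1r mulN1r addNr.
have dec v : exists x0 x1 y0 y1 : F,
  [/\ X v = x0%:A + x1%:A * i, Y v = y0%:A + y1%:A * i &
      v = x0 *: a0 + (x1 *: a1 + (y0 *: b0 + (y1 *: b1 + 0)))].
  have [x0 [x1 Xv]] := span_i (X v); have [y0 [y1 Yv]] := span_i (Y v).
  exists x0, x1, y0, y1; split=> //; apply/eqP; rewrite -subr_eq0; apply/eqP.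
  rewrite addrC -scaleN1r; apply: XY_inj; rewrite ?XE ?YE.
    by rewrite Xa0 Xa1 Xb0 Xb1 X0 Xv scaleN1r; ring.
  by rewrite Ya0 Ya1 Yb0 Yb1 Y0 Yv scaleN1r; ring.
pose W x y := (web z x y)%:A : L.
have cW x y : conj (W x y) = W x y by apply: rmorph_alg.
have W_C x y : W x y = W y x by rewrite /W webC.
have web_expand v x : W v x = re_ (X v) * W a0 x + im_ (X v) * W a1 x +
    re_ (Y v) * W b0 x + im_ (Y v) * W b1 x.
  have [x0 [x1 [y0 [y1 [-> -> {1}->]]]]] := dec v.
  by rewrite !reE !imE /W !webE web0l addr0 !scalerDl !algM; ring.
exists ((W a0 a0 + 2 * W a0 a1 / i + W a1 a1 / i ^+ 2) / 4),
  ((W a0 a0 - W a1 a1 / i ^+ 2) / 4),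
  ((W a0 b0 + W a0 b1 / i + W a1 b0 / i + W a1 b1 / i ^+ 2) / 4),
  ((W a0 b0 - W a0 b1 / i + W a1 b0 / i - W a1 b1 / i ^+ 2) / 4),
  ((W b0 b0 + 2 * W b0 b1 / i + W b1 b1 / i ^+ 2) / 4),
  ((W b0 b0 - W b1 b1 / i ^+ 2) / 4).
split.
- rewrite ?(rmorph_nat, rmorphB, rmorphN, rmorphD, rmorphM, fmorphV, rmorphXn) /= !cW conj_i.
  by field; rewrite ?oppr_eq0 ?i0 ?four_neq0 ?two_neq0L.
- rewrite ?(rmorph_nat, rmorphB, rmorphN, rmorphD, rmorphM, fmorphV, rmorphXn) /= !cW conj_i.
  by field; rewrite ?oppr_eq0 ?i0 ?four_neq0 ?two_neq0L.
move=> u v; rewrite -/(W u v) web_expand (W_C a0 v) (W_C a1 v) (W_C b0 v) (W_C b1 v).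
rewrite !(web_expand v) (W_C a1 a0) (W_C b0 a0) (W_C b0 a1) (W_C b1 a0) (W_C b1 a1) (W_C b1 b0).
move: (X u) (Y u) (X v) (Y v) => x y x' y'.
rewrite /bform /trace /re_ /im_.
rewrite ?(rmorph_nat, rmorphB, rmorphN, rmorphD, rmorphM, fmorphV, rmorphXn) /=.
rewrite ?conjK !cW conj_i.
by field; rewrite ?oppr_eq0 ?i0 ?four_neq0 ?two_neq0L.
Qed.

Lemma has_form_comb X Y z z' al be th ta ga de al' be' th' ta' ga' de' (a a' : F) :
  has_form X Y z al be th ta ga de ->
  has_form X Y z' al' be' th' ta' ga' de' ->
  has_form X Y (a *: z + a' *: z') (a%:A * al + a'%:A * al')
    (a%:A * be + a'%:A * be') (a%:A * th + a'%:A * th')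
    (a%:A * ta + a'%:A * ta') (a%:A * ga + a'%:A * ga')
    (a%:A * de + a'%:A * de').
Proof.
move=> fz fz' u v; rewrite !webE scalerDl !algM fz fz' /bform /trace.
rewrite ?(rmorphD, rmorphM) /= !rmorph_alg.
by move: (X u) (Y u) (X v) (Y v) => x y x' y'; ring.
Qed.

Lemma has_form_nondegenerate X Y z al be th ta ga de : frame X Y ->
    has_form X Y z al be th ta ga de -> conj be = be -> conj de = de ->
  z != 0 -> gram_det conj al be th ta ga de != 0.
Proof.
move=> [X_lin Y_lin XY_inj XY_surj] fz cbe cde z0; apply/eqP => det0.
have [x [y [nz deg]]] := bform_degenerate conjK two_neq0L cbe cde i0 conj_i det0.
have [u [Xu Yu]] := XY_surj x y.
have [|v] := @web_neq0 z u z0.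
  apply: contraNneq nz => u0; rewrite -Xu -Yu u0.
  have X0 : X 0 = 0 by have := X_lin (-1) 0 0; rewrite scaleN1r addNr scaleN1r addNr.
  have Y0 : Y 0 = 0 by have := Y_lin (-1) 0 0; rewrite scaleN1r addNr scaleN1r addNr.
  by rewrite X0 Y0 !eqxx.
have := fz u v; rewrite Xu Yu deg => /eqP.
by rewrite scaler_eq0 oner_eq0 orbF => ->.
Qed.

Definition basis_family X Y (kap : bool) al3 ga3 al4 ga4 :=
  (forall th (a b : F), exists z,
    has_form X Y z (a%:A * al3 + b%:A * al4) 0 th 0
      (a%:A * ga3 + b%:A * ga4 + conj th *+ kap) 0 /\
    (~~ [&& th == 0, a == 0 & b == 0] -> z != 0)) /\
  forall z, exists th (a b : F),
    has_form X Y z (a%:A * al3 + b%:A * al4) 0 th 0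
      (a%:A * ga3 + b%:A * ga4 + conj th *+ kap) 0.

Lemma diagonal_frame : search_facts conj ->
  exists X Y kap al3 ga3 al4 ga4, frame X Y /\ basis_family X Y kap al3 ga3 al4 ga4.
Proof.
case=> search _ _.
have [X [Y [kap [z1 [z2 [XY indz [T [T00 T_surj pencil]]]]]]]] := pencil_frame.
exists X, Y, kap.
pose inP w := exists s t, w = s *: z1 + t *: z2.
pose indP w3 w4 := forall p (s t : F), inP p -> p + s *: w3 + t *: w4 = 0 -> s = 0 /\ t = 0.
have inP_comb p p' (a b : F) : inP p -> inP p' -> inP (a *: p + b *: p').
  case=> [s [t ->]] [s' [t' ->]]; exists (a * s + b * s'), (a * t + b * t').
  by rewrite !scalerDr !scalerA !scalerDl addrACA.
suff finish m3 m4 al3 ta3 ga3 de3 al4 be4 ta4 ga4 de4 : indP m3 m4 ->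
    conj de3 = de3 -> conj be4 = be4 -> conj de4 = de4 ->
    has_form X Y m3 al3 0 0 ta3 ga3 de3 -> has_form X Y m4 al4 be4 0 ta4 ga4 de4 ->
  basis_family X Y kap al3 ga3 al4 ga4.
  have [n3 [n4 ind34]] : exists n3 n4, indP n3 n4.
    have [n3 n3P] : exists n3, forall s, line_point z1 z2 s != n3.
      apply: pigeonhole_notin; rewrite card_row2 card_V ltn_exp2l //; exact: q_gt1.
    have [n4 n4P] : exists n4, forall s : 'rV[F]_2 * F, line_point z1 z2 s.1 + s.2 *: n3 != n4.
      apply: pigeonhole_notin; rewrite card_prod card_row2 card_V -expnSr ltn_exp2l //.
      exact: q_gt1.
    exists n3, n4 => p s t [a [b ->]] e.
    have lineE x y k : k *: (x *: z1 + y *: z2) =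
        line_point z1 z2 (\row_j if j == 0 then k * x else k * y).
      by rewrite /line_point !mxE /= scalerDr !scalerA.
    have t0 : t = 0.
      apply/eqP; apply: contraT => t0.
      have := n4P (\row_j if j == 0 then - t^-1 * a else - t^-1 * b, - t^-1 * s).
      rewrite /= -lineE -scalerA -scalerDr => /eqP[].
      by rewrite -[n4 in RHS]scale1r -(mulVf t0) -scalerA scaleNr -scalerN;
        congr (_ *: _); apply/eqP; rewrite eq_sym -addr_eq0 addrC e.
    split=> //; apply/eqP; apply: contraT => s0; move: e; rewrite t0 scale0r addr0 => e.
    have := n3P (\row_j if j == 0 then - s^-1 * a else - s^-1 * b).
    rewrite -lineE => /eqP[].
    by rewrite -[n3 in RHS]scale1r -(mulVf s0) -scalerA scaleNr -scalerN;
      congr (_ *: _); apply/eqP; rewrite eq_sym -addr_eq0 addrC e.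
  (* Every value of th occurs in the pencil, so subtracting a member of it clears th. *)
  have reduce n : exists p al be ta ga de, [/\ inP p, conj be = be, conj de = de &
      has_form X Y (n - p) al be 0 ta ga de].
    have [al [be [th [ta [ga [de [cbe cde fn]]]]]]] := form_expand n XY.
    have [s [t tE]] := T_surj th; exists (s *: z1 + t *: z2).
    have := has_form_comb 1 (-1) fn (pencil s t).
    rewrite tE !scale1r !scaleN1r !mul1r !mulr0 !addr0 mulN1r subrr => fnp.
    by do 5 eexists; split; [exists s, t|exact: cbe|exact: cde|exact: fnp].
  have [p3 [al3 [be3 [ta3 [ga3 [de3 [p3P cbe3 cde3 f3]]]]]]] := reduce n3.
  have [p4 [al4 [be4 [ta4 [ga4 [de4 [p4P cbe4 cde4 f4]]]]]]] := reduce n4.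
  have ind : indP (n3 - p3) (n4 - p4).
    move=> p s t pP e; apply: (ind34 (1 *: (1 *: p + - s *: p3) + - t *: p4)).
      exact: inP_comb (inP_comb _ _ _ _ pP p3P) p4P.
    rewrite -[RHS]e !scale1r !scalerBr !scaleNr -!addrA; congr (_ + _).
    rewrite [RHS]addrCA; congr (_ + _).
    by rewrite addrCA; congr (_ + _); rewrite addrC.
  (* The search expects be = 0 in the first form. If be3 is nonzero, a combination of the two forms
     with be = 0 takes that place and the old first form becomes the second. *)
  have [b3 b3E] := conj_fixed conj_i span_i two_neq0 cbe3.
  have [b30|b30] := eqVneq b3 0.
    have be30 : be3 = 0 by rewrite b3E b30 scale0r.
    exists al3, ga3, al4, ga4; split=> //.
    by rewrite be30 in f3; apply: finish ind cde3 cbe4 cde4 f3 f4.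
  have [b4 b4E] := conj_fixed conj_i span_i two_neq0 cbe4.
  have f3' := has_form_comb b4 (- b3) f3 f4.
  have b3N : (- b3)%:A = - b3%:A :> L by rewrite scaleNr.
  have be0 : b4%:A * be3 + (- b3)%:A * be4 = 0 by rewrite b3N b3E b4E mulNr mulrC subrr.
  rewrite be0 !mulr0 addr0 in f3'.
  exists (b4%:A * al3 + (- b3)%:A * al4), (b4%:A * ga3 + (- b3)%:A * ga4), al3, ga3.
  split=> //; apply: (finish _ _ _ _ _ _ _ _ _ _ _ _ _ cbe3 cde3 f3' f3); last first.
    by rewrite rmorphD !rmorphM /= !rmorph_alg cde3 cde4.
  move=> p s t pP e; have [] := ind _ (s * b4 + t) (- (s * b3)) pP.
      rewrite -[RHS]e (scalerDr s) !scalerA scalerDl -mulrN -!addrA.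
      by congr (_ + (_ + _)); rewrite addrC.
    move=> st /eqP; rewrite oppr_eq0 mulf_eq0 (negbTE b30) orbF => /eqP s0.
    by move: st; rewrite s0 mul0r add0r.
move=> ind34 cde3 cbe4 cde4 f3 f4.
have z_form s t a b : has_form X Y (1 *: (s *: z1 + t *: z2) + 1 *: (a *: m3 + b *: m4))
    (a%:A * al3 + b%:A * al4) (b%:A * be4) (T s t) (a%:A * ta3 + b%:A * ta4)
    (a%:A * ga3 + b%:A * ga4 + conj (T s t) *+ kap) (a%:A * de3 + b%:A * de4).
  have := has_form_comb 1 1 (pencil s t) (has_form_comb a b f3 f4).
  by rewrite !scale1r !mul1r !mulr0 !add0r !addr0 [_ *+ kap + _]addrC.
have z_neq0 s t a b : ~~ [&& T s t == 0, a == 0 & b == 0] ->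
    1 *: (s *: z1 + t *: z2) + 1 *: (a *: m3 + b *: m4) != 0.
  apply: contraNneq; rewrite !scale1r addrA => e.
  have [a0 b0] := ind34 _ _ _ (ex_intro _ s (ex_intro _ t erefl)) e.
  move: e; rewrite a0 b0 !scale0r !addr0 !eqxx !andbT => /eqP.
  have [st|] := boolP ((s != 0) || (t != 0)); first by rewrite (negbTE (indz _ _ st)).
  by rewrite negb_or !negbK => /andP[/eqP-> /eqP->] _; rewrite T00.
have ns : nonsingular conj kap al3 ta3 ga3 de3 al4 be4 ta4 ga4 de4.
  move=> th r r' /(conj_fixed conj_i span_i two_neq0)[a ->].
  move=> /(conj_fixed conj_i span_i two_neq0)[b ->]; have [s [t <-]] := T_surj th.
  rewrite !scaler_eq0 oner_eq0 !orbF => nz.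
  apply: (has_form_nondegenerate XY (z_form s t a b)); last exact: z_neq0.
  - by rewrite rmorphM /= rmorph_alg cbe4.
  - by rewrite rmorphD !rmorphM /= !rmorph_alg cde3 cde4.
have [be40 ta30 de30 ta40 de40] := search _ _ _ _ _ _ _ _ _ _ cde3 cbe4 cde4 ns.
split=> [th a b|z].
  have [s [t tE]] := T_surj th.
  exists (1 *: (s *: z1 + t *: z2) + 1 *: (a *: m3 + b *: m4)); split.
    by have := z_form s t a b; rewrite be40 ta30 de30 ta40 de40 tE !mulr0 !addr0.
  by rewrite -tE; apply: z_neq0.
(* Five vectors of F^4 are dependent, and z must occur in the relation because the other four are
   independent. *)
pose k (s : 'rV[F]_5) := s 0 (Ordinal (isT : 0 < 5)%N) *: z1 +
  s 0 (Ordinal (isT : 1 < 5)%N) *: z2 + s 0 (Ordinal (isT : 2 < 5)%N) *: m3 +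
  s 0 (Ordinal (isT : 3 < 5)%N) *: m4 + s 0 (Ordinal (isT : 4 < 5)%N) *: z.
have kD : {morph k : x y / x + y}.
  move=> x y; rewrite /k !mxE !scalerDl.
  by do 4![rewrite [RHS]addrACA; congr (_ + _)].
have [|s s0 ks] := pigeonhole_neq0 kD.
  by rewrite !card_mx !mul1n ltn_exp2l // q_gt1.
move: ks; rewrite /k; set a1 := s 0 _; set a2 := s 0 _; set a3 := s 0 _.
set a4 := s 0 _; set a5 := s 0 _ => ks.
have a50 : a5 != 0.
  apply: contraNneq s0 => a50; move: ks; rewrite a50 scale0r addr0 => ks.
  have [a30 a40] := ind34 _ _ _ (ex_intro _ a1 (ex_intro _ a2 erefl)) ks.
  move: ks; rewrite a30 a40 !scale0r !addr0 => /eqP.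
  have [nz|] := boolP ((a1 != 0) || (a2 != 0)); first by rewrite (negbTE (indz _ _ nz)).
  rewrite negb_or !negbK => /andP[/eqP a10 /eqP a20] _.
  apply/eqP/rowP => -[[|[|[|[|[|//]]]]] lt_j]; rewrite mxE.
  - by rewrite -[RHS]a10; congr (s _ _); apply: val_inj.
  - by rewrite -[RHS]a20; congr (s _ _); apply: val_inj.
  - by rewrite -[RHS]a30; congr (s _ _); apply: val_inj.
  - by rewrite -[RHS]a40; congr (s _ _); apply: val_inj.
  by rewrite -[RHS]a50; congr (s _ _); apply: val_inj.
have zE : z = 1 *: (- a5^-1 * a1 *: z1 + - a5^-1 * a2 *: z2) +
    1 *: (- a5^-1 * a3 *: m3 + - a5^-1 * a4 *: m4).
  rewrite !scale1r -!scalerA -!scalerDr addrA.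
  move/eqP: ks; rewrite addr_eq0 => /eqP->.
  by rewrite scaleNr scalerN opprK scalerA mulVf // scale1r.
have := z_form (- a5^-1 * a1) (- a5^-1 * a2) (- a5^-1 * a3) (- a5^-1 * a4).
rewrite -zE be40 ta30 de30 ta40 de40 !mulr0 !addr0 => fz.
by do 3 eexists; exact: fz.
Qed.

Definition family X Y (kap : bool) m n :=
  (forall al th, exists z,
    has_form X Y z al 0 th 0 (m * al + n * conj al + conj th *+ kap) 0 /\
    ((al != 0) || (th != 0) -> z != 0)) /\
  forall z, exists al th,
    has_form X Y z al 0 th 0 (m * al + n * conj al + conj th *+ kap) 0.

Lemma gram_det_diagonal al th ga :
  gram_det conj al 0 th 0 ga 0 = norm conj (al * ga - th ^+ 2).
Proof.
rewrite /gram_det /norm /trace ?(rmorph0, rmorphB, rmorphM, rmorphXn) /= ?conjK.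
by rewrite ?(rmorphD, rmorphN, rmorphM, rmorphXn, rmorph0) /= ?conjK; ring.
Qed.

Lemma diagonal_neq0 X Y z al th ga : frame X Y ->
  has_form X Y z al 0 th 0 ga 0 -> z != 0 -> al * ga != th ^+ 2.
Proof.
move=> XY fz z0; have := has_form_nondegenerate XY fz (rmorph0 _) (rmorph0 _) z0.
by rewrite gram_det_diagonal /norm mulf_eq0 fmorph_eq0 orbb subr_eq0.
Qed.

(** A nonzero member with al = th = 0 would be degenerate, so al3, al4 is a basis of L over F, and
    al determines ga up to the twist. Every F-linear map of L has the shape m al + n al^; Cramer's
    rule with determinant [D] gives m and n. *)
Lemma basis_family_family X Y kap al3 ga3 al4 ga4 : frame X Y ->
  basis_family X Y kap al3 ga3 al4 ga4 -> exists m n, family X Y kap m n.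
Proof.
move=> XY [zs forms].
have indep (a b : F) : a%:A * al3 + b%:A * al4 = 0 -> a = 0 /\ b = 0.
  move=> e; have [z [fz nz]] := zs 0 a b; rewrite e in fz.
  have [/andP[/eqP-> /eqP->]//|ab] := boolP ((a == 0) && (b == 0)).
  have := diagonal_neq0 XY fz; rewrite mul0r expr0n eqxx => /(_ (nz _)) /=.
  by rewrite eqxx /= ab => /(_ isT).
pose D := al3 * conj al4 - al4 * conj al3.
have D0 : D != 0.
  rewrite subr_eq0; apply/eqP => e.
  have al40 : al4 != 0.
    apply/eqP => al40; have [|_ /eqP] := indep 0 1.
      by rewrite al40 mulr0 addr0 scale0r mul0r.
    by rewrite oner_eq0.
  have : conj (al3 / al4) = al3 / al4.
    apply/eqP; rewrite fmorph_div /= eqr_div ?fmorph_eq0 // eq_sym e mulrC.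
    by [].
  case/(conj_fixed conj_i span_i two_neq0) => a aE.
  have [|/eqP] := indep 1 (- a).
    by rewrite scale1r mul1r scaleNr -aE mulNr divfK // subrr.
  by rewrite oner_eq0.
have cD : conj D = - D.
  by rewrite /D rmorphB !rmorphM /= !conjK; ring.
pose m := (ga3 * conj al4 - ga4 * conj al3) / D.
pose n := (al3 * ga4 - al4 * ga3) / D.
have gaE (a b : F) : a%:A * ga3 + b%:A * ga4 =
    m * (a%:A * al3 + b%:A * al4) + n * conj (a%:A * al3 + b%:A * al4).
  rewrite rmorphD !rmorphM /= !rmorph_alg /m /n.
  by move: D0; rewrite /D => D0; field.
exists m, n; split=> [al th|z]; last first.
  have [th [a [b fz]]] := forms z; rewrite gaE in fz.
  by exists (a%:A * al3 + b%:A * al4), th.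
have [a aE] : exists a : F, (al * conj al4 - al4 * conj al) / D = a%:A.
  apply: (conj_fixed conj_i span_i two_neq0).
  rewrite fmorph_div /= cD rmorphB !rmorphM /= !conjK.
  by field; rewrite ?oppr_eq0 D0.
have [b bE] : exists b : F, (al3 * conj al - al * conj al3) / D = b%:A.
  apply: (conj_fixed conj_i span_i two_neq0).
  rewrite fmorph_div /= cD rmorphB !rmorphM /= !conjK.
  by field; rewrite ?oppr_eq0 D0.
have alE : al = a%:A * al3 + b%:A * al4.
  by rewrite -aE -bE; move: D0; rewrite /D => D0; field.
have [z [fz nz]] := zs th a b; exists z; split.
  by rewrite gaE -alE in fz.
move=> alth; apply: nz; apply: contraTN alth => /and3P[/eqP-> /eqP a0 /eqP b0].
by rewrite alE a0 b0 !scale0r !mul0r addr0 eqxx.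
Qed.

Lemma bform_diagonal al th ga x y x' y' : bform conj al 0 th 0 ga 0 x y x' y' =
  trace conj (al * (x * x') + th * (x * y' + x' * y) + ga * (y * y')).
Proof.
by rewrite /bform /trace ?(rmorphD, rmorphM, rmorph0) /= ?conjK; ring.
Qed.

Lemma frame_change X Y r s : frame X Y -> r != s ->
  frame (fun v => X v - r * Y v) (fun v => X v - s * Y v).
Proof.
move=> [X_lin Y_lin XY_inj XY_surj] rs; have rs0 : r - s != 0 by rewrite subr_eq0.
have XE a v w : X (a *: v + w) = a%:A * X v + X w by rewrite X_lin mulr_algl.
have YE a v w : Y (a *: v + w) = a%:A * Y v + Y w by rewrite Y_lin mulr_algl.
split=> [a v w|a v w|v Xv Yv|x y].
- by rewrite -mulr_algl XE YE; ring.
- by rewrite -mulr_algl XE YE; ring.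
- have : (r - s) * Y v = 0.
    by rewrite -[RHS](subrr 0) -{1}Yv -Xv; ring.
  move/eqP; rewrite mulf_eq0 (negbTE rs0) => /eqP Y0.
  by apply: XY_inj => //; move: Xv; rewrite Y0 mulr0 subr0.
have [v [Xv Yv]] := XY_surj (x + r * ((y - x) / (r - s))) ((y - x) / (r - s)).
by exists v; rewrite Xv Yv; split; [ring|field].
Qed.

Lemma bform_change al th ga x y x' y' r s (k := (r - s)^-1) : r - s != 0 ->
  bform conj al 0 th 0 ga 0 x y x' y' =
  bform conj (al * (1 - r * k) ^+ 2 - 2 * th * k * (1 - r * k) + ga * k ^+ 2) 0
    (al * (1 - r * k) * (r * k) + th * (k * (1 - r * k) - r * k ^+ 2) - ga * k ^+ 2) 0
    (al * (r * k) ^+ 2 + 2 * th * r * k ^+ 2 + ga * k ^+ 2) 0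
    (x - r * y) (x - s * y) (x' - r * y') (x' - s * y').
Proof.
move=> rs0; rewrite !bform_diagonal; congr (trace conj _); rewrite /k.
by field.
Qed.

(* If n^^2 - m = e^2, then t^2 - 2 n^ t + m has the roots r, s = n^ + e, n^ - e,
   and X - r Y, X - s Y is the new frame. *)
Lemma untwist X Y m n : search_facts conj -> frame X Y -> family X Y true m n ->
  exists X' Y' al3 ga3 al4 ga4, frame X' Y' /\
    basis_family X' Y' false al3 ga3 al4 ga4.
Proof.
case=> _ square_or_zero _ XY [zs forms]; pose nb := conj n; pose d := nb ^+ 2 - m.
have cnb : conj nb = n by apply: conjK.
have ndeg al th : (al != 0) || (th != 0) ->
    al * (m * al + n * conj al + conj th) != th ^+ 2.
  by move=> nz; have [z [fz /(_ nz) z0]] := zs al th; apply: diagonal_neq0 fz z0.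
(* For al = 1 and th = -nb one has al ga = m and th^2 = nb^2. *)
have d0 : d != 0.
  apply/eqP => d0; have := ndeg 1 (- nb); rewrite oner_eq0 => /(_ isT) /eqP[].
  rewrite rmorph1 rmorphN /= cnb; apply/eqP; rewrite -subr_eq0 -oppr_eq0 -d0 /d.
  by apply/eqP; ring.
have [e de] : exists e, d = e ^+ 2.
  have [//|[w [x [w0 wx]]]] := square_or_zero (2 * nb) d.
  (* With th = w - nb al, degeneracy reads d al^2 - (2 nb w + w^) al + w^2 = 0; this al is a root,
     x^2 being the discriminant. *)
  pose al := (2 * nb * w + conj w + x) / (2 * d).
  have := ndeg al (w - nb * al).
  have -> : (al != 0) || (w - nb * al != 0).
    by have [->|//] := eqVneq al 0; rewrite mulr0 subr0.
  move=> /(_ isT) /eqP[]; apply/eqP.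
  rewrite -subr_eq0 rmorphB (rmorphM _ nb) /= cnb.
  have -> : al * (m * al + n * conj al + (conj w - n * conj al)) - (w - nb * al) ^+ 2 =
      - (d * al ^+ 2 - al * (2 * nb * w + conj w) + w ^+ 2) by rewrite /d; ring.
  rewrite (_ : d * al ^+ 2 - al * (2 * nb * w + conj w) + w ^+ 2 =
    (x ^+ 2 - ((2 * nb * w + conj w) ^+ 2 - 4 * (d * w ^+ 2))) / (4 * d)).
    by rewrite wx subrr mul0r oppr0.
  have four_neq0 : 4 != 0 :> L by rewrite (_ : 4 = 2 * 2) ?mulf_neq0 //; ring.
  by rewrite /al; field; rewrite d0 ?two_neq0L ?four_neq0.
have e0 : e != 0 by apply: contraNneq d0 => e0; rewrite de e0 expr0n.
have mE : m = nb ^+ 2 - e ^+ 2 by rewrite -de /d; ring.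
pose r := nb + e; pose s := nb - e.
have rsE : r - s = 2 * e by rewrite /r /s; ring.
have rs0 : r - s != 0 by rewrite rsE mulf_neq0.
pose k := (2 * e)^-1.
(* For th = psi - nb al the conjugate of al cancels in ga, and al multiplies X X' - nb (X Y' + X' Y)
   + m Y Y', the symmetrized product of X - r Y and X - s Y. In the new frame al therefore enters
   the mixed coefficient only, where it is free; [A], [T], [G] are the contributions of psi. *)
pose A psi := - 2 * k * (1 - r * k) * psi + k ^+ 2 * conj psi.
pose T psi := (k * (1 - r * k) - r * k ^+ 2) * psi - k ^+ 2 * conj psi.
pose G psi := 2 * r * k ^+ 2 * psi + k ^+ 2 * conj psi.
exists (fun v => X v - r * Y v), (fun v => X v - s * Y v), (A 1), (G 1), (A i), (G i).
split; first by apply: frame_change; rewrite // -subr_eq0.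
have change z al th psi : th = psi - nb * al ->
    has_form X Y z al 0 th 0 (m * al + n * conj al + conj th) 0 ->
    has_form (fun v => X v - r * Y v) (fun v => X v - s * Y v) z
      (A psi) 0 (al / 2 + T psi) 0 (G psi) 0.
  move=> -> fz u v; rewrite fz (bform_change _ _ _ _ _ _ _ rs0) rsE -/k.
  rewrite rmorphB (rmorphM _ nb) /= cnb.
  congr bform; rewrite /A /T /G /k mE /r; field; rewrite ?e0 ?two_neq0L //.
have AE (a b : F) : A (a%:A + b%:A * i) = a%:A * A 1 + b%:A * A i.
  by rewrite /A rmorphD rmorphM !rmorph1 /= !rmorph_alg; ring.
have GE (a b : F) : G (a%:A + b%:A * i) = a%:A * G 1 + b%:A * G i.
  by rewrite /G rmorphD rmorphM !rmorph1 /= !rmorph_alg; ring.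
split=> [th a b|z].
  pose psi := a%:A + b%:A * i; pose al := 2 * (th - T psi).
  have [z [fz nz]] := zs al (psi - nb * al); exists z; split.
    have := change _ _ _ psi erefl fz.
    rewrite mulr0n addr0 -AE -GE -/psi (_ : al / 2 + T psi = th) //.
    by rewrite /al; field.
  move=> nz0; apply: nz; apply: contraNT nz0; rewrite negb_or !negbK.
  move=> /andP[/eqP al0]; rewrite al0 mulr0 subr0 => /eqP psi0.
  have [-> ->] := alg_i_eq0 conj_i i2 lam_ns two_neq0 psi0.
  rewrite !eqxx !andbT; move/eqP: al0; rewrite /al mulf_eq0 (negbTE two_neq0L) /=.
  by rewrite psi0 /T rmorph0 !mulr0 subrr subr0.
have [al [th fz]] := forms z.
have [a [b psiE]] := span_i (th + nb * al).
exists (al / 2 + T (th + nb * al)), a, b; rewrite mulr0n addr0 -AE -GE -psiE.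
by apply: change fz; rewrite addrK.
Qed.

Lemma dickson_frame : search_facts conj -> exists X Y (twist : bool) eta,
  [/\ frame X Y, forall w, eta != w ^+ 2 &
    forall z, exists al th, forall u v, (web z u v)%:A = trace conj
      (al * (X u * X v + eta * (if twist then conj (Y u * Y v) else Y u * Y v)) +
       th * (X u * Y v + Y u * X v))].
Proof.
move=> facts; have [X [Y [kap [al3 [ga3 [al4 [ga4 [XY fam]]]]]]]] := diagonal_frame facts.
have {X Y kap al3 ga3 al4 ga4 XY fam} [X [Y [m [n [XY [zs forms]]]]]] :
    exists X Y m n, frame X Y /\ family X Y false m n.
  have [m [n fam2]] := basis_family_family XY fam.
  case: kap fam fam2 => fam fam2; last by exists X, Y, m, n.
  have [X' [Y' [a3 [g3 [a4 [g4 [XY' fam']]]]]]] := untwist facts XY fam2.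
  by have [m' [n' fam3]] := basis_family_family XY' fam'; exists X', Y', m', n'.
have ndeg al th : (al != 0) || (th != 0) -> al * (m * al + n * conj al) != th ^+ 2.
  move=> nz; have [z [fz /(_ nz) z0]] := zs al th.
  by have := diagonal_neq0 XY fz z0; rewrite mulr0n addr0.
have one_or w : (1 != 0 :> L) || (w != 0 :> L) by rewrite oner_eq0.
have [n0|n0] := eqVneq n 0.
  exists X, Y, false, m; split=> // [w|z].
    by have := ndeg 1 w (one_or w); rewrite n0 !mul1r mul0r addr0 mulr1.
  have [al [th fz]] := forms z; exists al, th => u v; rewrite fz bform_diagonal n0.
  by congr (trace conj _); rewrite mulr0n; ring.
have [m0|m0] := eqVneq m 0; last first.
  case: facts => _ _ /(_ m n m0 n0)[al [x [al0 alE]]].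
  by have := ndeg al x; rewrite al0 alE eqxx => /(_ isT).
(* Under the trace, n al^ Y Y' may be replaced by its conjugate n^ al (Y Y')^, whence eta = n^. *)
have twistE al th x y x' y' : trace conj (al * (x * x') + th * (x * y' + x' * y) +
      (m * al + n * conj al + conj th *+ false) * (y * y')) =
    trace conj (al * (x * x' + conj n * conj (y * y')) + th * (x * y' + y * x')).
  rewrite m0 mulr0n /trace ?(rmorphD, rmorphM, rmorph0) /= ?conjK; ring.
exists X, Y, true, (conj n); split=> // [w|z].
  have := ndeg 1 (conj w) (one_or _); rewrite m0 rmorph1 mul0r add0r mulr1 mul1r.
  by rewrite -rmorphXn; apply: contraNneq => /(congr1 conj); rewrite conjK => ->.
by have [al [th fz]] := forms z; exists al, th => u v; rewrite fz bform_diagonal twistE.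
Qed.

End Frames.

End Presemifield.

(** * Isotopism with a Dickson semifield and the permuted array *)

Lemma inj_surj_bij (A B : choiceType) (f : A -> B) :
  injective f -> (forall y, exists x, f x = y) -> bijective f.
Proof.
move=> f_inj f_surj.
have f_surjb y : exists x, f x == y by have [x <-] := f_surj y; exists x.
have fK y : f (xchoose (f_surjb y)) = y by apply/eqP/(xchooseP (f_surjb y)).
by exists (fun y => xchoose (f_surjb y)) => // x; apply: f_inj; rewrite fK.
Qed.

(* If X v0 = 1 and Y v0 = 0, every form determined by its values of
   X u X v + eta (Y u Y v)^tau and X u Y v + Y u X v agrees at (u, v) and at
   (v0, w), where w has these two values as coordinates; so c u v = c v0 w. *)
Lemma dickson_isotopic (F : finFieldType) (L : splittingFieldType F)
    (sigma : gal_of {:L}) (i : L) (lam : F)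
    (P : 'rV[F]_4 -> 'rV[F]_4 -> 'rV[F]_4) (N : 'M[F]_4)
    (c := fun u v => P u (v *m N)) :
  sigma \in ('Gal({:L} / 1))%g -> sigma i = - i -> i ^+ 2 = lam%:A ->
  (forall x : L, exists a b : F, x = a%:A + b%:A * i) ->
  (forall x, x ^+ 2 != lam) -> 2 != 0 :> F -> search_facts sigma ->
  N \in unitmx -> commutative c -> (forall u, linear (c u)) ->
  (forall u v, c u v = 0 -> u = 0 \/ v = 0) ->
  exists (tau : gal_of {:L}) (eta : L), [/\ tau \in ('Gal({:L} / 1))%g,
    ~ (exists z : L, eta = z ^+ 2) & isotopic P (dickson_mul tau eta)].
Proof.
move=> galS conj_i i2 span_i lam_ns two_neq0 facts Nu cC c_linear c_nzd.
have [X [Y [tw [eta [[X_lin Y_lin XY_inj XY_surj] eta_ns forms]]]]] :=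
  dickson_frame cC c_linear c_nzd conj_i i2 span_i lam_ns two_neq0 facts.
exists (if tw then sigma else 1%g), eta; split.
- by case: (tw).
- by case=> z etaE; have := eta_ns z; rewrite etaE eqxx.
pose f v := (X v, Y v).
have f_lin : linear f by move=> a u v; rewrite /f X_lin Y_lin.
pose fL : {linear 'rV[F]_4 -> (L * L)%type} :=
  HB.pack f (GRing.isLinear.Build _ _ _ _ f f_lin).
have f_bij : bijective fL.
  apply: inj_surj_bij => [u v fuv|[x y]]; last first.
    by have [v [<- <-]] := XY_surj x y; exists v.
  apply/eqP; rewrite -subr_eq0; apply/eqP.
  have : fL (u - v) = 0 by rewrite linearB fuv subrr.
  by case; apply: XY_inj.
have [v0 [Xv0 Yv0]] := XY_surj 1 0.
have v0_neq0 : v0 != 0.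
  apply: contra_eq_neq Xv0 => ->; rewrite -[X 0]/(fL 0).1 linear0 eq_sym.
  exact: oner_neq0.
pose M := HB.pack_for {linear 'rV[F]_4 -> 'rV[F]_4} (c v0)
  (GRing.isLinear.Build _ _ _ _ (c v0) (c_linear v0)).
have M_bij : bijective M.
  apply: injF_bij => u v Muv; apply/eqP; rewrite -subr_eq0; apply/eqP.
  have : c v0 (u - v) = 0 by rewrite -[c v0]/(M : _ -> _) linearB Muv subrr.
  by case/c_nzd => // v00; rewrite v00 eqxx in v0_neq0.
have [M' MK M'K] := M_bij; have [f' fK f'K] := f_bij.
(* Since P x y = c x (y N^-1), the second map of the isotopism undoes N; the third one undoes the
   operator c v0. *)
pose gM : {linear 'rV[F]_4 -> (L * L)%type} := fL \o (mulmxr (invmx N)).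
pose ML : {linear 'rV[F]_4 -> 'rV[F]_4} :=
  HB.pack M' (GRing.isLinear.Build _ _ _ _ M' (can2_linear MK M'K)).
exists fL, gM, (fL \o ML); split=> //.
- apply: bij_comp => //; exists (mulmxr N) => v /=; first by rewrite mulmxKV.
  by rewrite mulmxK.
- by apply: bij_comp => //; exists M.
move=> x y; rewrite /= -[y in RHS](mulmxKV Nu); set v := y *m _.
rewrite -[P _ _]/(c x v); set w := f' (dickson_mul (if tw then sigma else 1%g) eta (fL x) (fL v)).
suff wE : M w = c x v by rewrite -wE MK -[f w]/(fL w) f'K.
have [Xw Yw] : (X w, Y w) = dickson_mul (if tw then sigma else 1%g) eta (fL x) (fL v).
  by rewrite -[LHS]/(fL w) f'K.
apply/eqP; rewrite -subr_eq0; apply/negPn/negP => /dot_neq0[z].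
rewrite -scaleN1r addrC dot_linear mulN1r addrC subr_eq0 => /eqP[].
apply: (fmorph_inj (in_alg L)) => /=; have [al [th fz]] := forms z.
rewrite -!/(web c z _ _) !fz Xv0 Yv0 Xw Yw !(mul1r, mul0r, mulr0, rmorph0, addr0, add0r).
by case: (tw); rewrite /= ?gal_id ?rmorph0 ?mulr0 ?addr0 ?(mulrC (Y x)) (addrC (X x * _)).
Qed.

Section SymplecticArray.

Import passmx.

(** Both sides are the sum of x_i z_k y_j times the coefficient of e_j in e_i * e_k: the swap of
    indices lets z act as second factor and y test the product. *)
Lemma dot_permuted_array (F : fieldType) (S : vectType F)
    (mul : {bilinear S -> S -> S}) (e : (\dim {:S}).-tuple S)
    (x y z : 'rV[F]_(\dim {:S})) :
  dot z (mul_of_array (permute_array (tperm 1 2) (cubical_array mul e)) x y) =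
  dot (rVof e (mul (vecof e x) (vecof e z))) y.
Proof.
have dotE (u v : 'rV[F]_(\dim {:S})) : dot u v = \sum_k u 0 k * v 0 k.
  by rewrite /dot mxE; apply: eq_bigr => k _; rewrite mxE.
rewrite !dotE; under eq_bigr => k _ do rewrite mxE big_distrr.
rewrite exchange_big /=.
transitivity (\sum_i \sum_j \sum_k
    x 0 i * z 0 k * coord e j (mul e`_i e`_k) * y 0 j).
  apply: eq_bigr => i _; under eq_bigr => k _ do rewrite big_distrr.
  rewrite exchange_big; apply: eq_bigr => j _; apply: eq_bigr => k _ /=.
  rewrite /permute_array permE /= ?tpermL ?tpermR ?tpermD // /cubical_array.
  rewrite !(tnth_nth 0) /=; ring.
rewrite exchange_big; apply: eq_bigr => j _ /=; rewrite -coord_rVof.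
rewrite /vecof linear_sumlz linear_sum big_distrl; apply: eq_bigr => i _ /=.
rewrite linear_sumr linear_sum big_distrl; apply: eq_bigr => k _ /=.
by rewrite linearZl_LR linearZr_LR !linearZ /=; ring.
Qed.

(* With phi a d = B (a, 0) (0, d), the isotropy of the spread elements reads
   phi a (c * y) = phi c (a * y); N is the matrix of phi, which makes
   <z, P u (v N)> equal to phi v (u * z). *)
Lemma symplectic_array (F : finFieldType) (S : vectType F)
    (mul : {bilinear S -> S -> S}) (e : (\dim {:S}).-tuple S)
    (P := mul_of_array (permute_array (tperm 1 2) (cubical_array mul e))) :
  basis_of fullv e -> no_zero_divisors mul -> symplectic mul ->
  exists2 N, N \in unitmx & let c u v := P u (v *m N) in
    [/\ commutative c, forall u, linear (c u) &
        forall u v, c u v = 0 -> u = 0 \/ v = 0].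
Proof.
move=> e_basis mul_nzd [B [/eqP Bnd _ Bspread Binfty]].
pose phi a d := B (a, 0) (0, d).
have BD u u' v v' : B (u + u') (v + v') = B u v + B u v' + (B u' v + B u' v').
  by rewrite linearDl !linearDr.
have pairE b d : (b, d) = (b, 0) + (0, d) :> (S * S)%type.
  by congr pair; rewrite /= ?addr0 ?add0r.
have phiC a c y : phi a (mul c y) = phi c (mul a y).
  have : B (a, mul a y) (c, mul c y) = 0 by apply: (Bspread y); apply: eqxx.
  rewrite (pairE a) (pairE c) BD.
  rewrite (Bspread 0 (a, 0) (c, 0)) ?inE /= ?linear0r //.
  rewrite (Binfty (0, _) (0, _)) ?inE //= add0r addr0.
  rewrite [X in _ + X]hermC /= expr1 mulN1r => /eqP; rewrite subr_eq0 => /eqP.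
  exact.
have phi_nd a : (forall d, phi a d = 0) -> a = 0.
  move=> phi0; have : (a, 0) \in orthov B fullv.
    apply/mem_orthovP => -[x d] _; rewrite (pairE x) linearDr /= -/(phi a d) phi0.
    by rewrite addr0 (Bspread 0) ?inE /= ?linear0r.
  by rewrite Bnd memv0 => /eqP[].
pose vec := vecof e; pose co := rVof e.
have vec0 : vec 0 = 0 by apply: linear0.
have vecK : cancel vec co := vecofK e_basis.
have coK : cancel co vec := rVofK e_basis.
have phi_linl d : scalar (phi^~ d).
  move=> a b b'; rewrite /phi -linearPl; congr (B _ _).
  by congr pair; rewrite /= scaler0 addr0.
have phi_linr a : scalar (phi a).
  move=> b d d'; rewrite /phi -linearPr; congr (B _ _).
  by congr pair; rewrite /= scaler0 addr0.
have sumE (f : S -> F) (x : 'rV_(\dim {:S})) : scalar f ->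
    f (vec x) = \sum_k x 0 k * f e`_k.
  move=> f_lin; pose fL : {scalar S} := HB.pack f (GRing.isLinear.Build _ _ _ _ f f_lin).
  rewrite -[f _]/(fL _) linear_sum; apply: eq_bigr => k _.
  by rewrite linearZ.
pose N : 'M[F]_(\dim {:S}) := \matrix_(i, j) phi e`_i e`_j.
have phi_dot m v : dot m (v *m N) = phi (vec v) (vec m).
  rewrite dotC /dot mxE (sumE _ m (phi_linr _)); apply: eq_bigr => j _.
  rewrite !mxE (sumE _ v (phi_linl _)) mulrC; congr (_ * _).
  by apply: eq_bigr => i _; rewrite !mxE.
have zE u v z : dot z (P u (v *m N)) = phi (vec v) (mul (vec u) (vec z)).
  by rewrite dot_permuted_array // phi_dot coK.
have dotI x y : (forall z, dot z x = dot z y) -> x = y.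
  move=> xy; apply/eqP; rewrite -subr_eq0; apply/negPn/negP => /dot_neq0[z].
  by rewrite -scaleN1r addrC dot_linear xy mulN1r addNr eqxx.
exists N.
  rewrite -row_free_unit; apply: inj_row_free => v vN.
  apply: (can_inj vecK); rewrite vec0; apply: phi_nd => d.
  by rewrite -[d]coK -phi_dot vN -(scale0r 0) dotZ mul0r.
split=> [u v|u a v w|u v uv0].
- by apply: dotI => z; rewrite !zE phiC.
- by apply: dotI => z; rewrite dot_linear !zE /vec linearP phi_linl.
have [->|u0] := eqVneq u 0; [by left|right].
apply: (can_inj vecK); rewrite vec0; apply: phi_nd => d.
(* For u nonzero, every d is of the form u * z, so phi v vanishes at every d. *)
have [g gK Kg] : bijective (fun z => co (mul (vec u) (vec z))).
  apply: injF_bij => z z' /(can_inj coK) /eqP.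
  rewrite -subr_eq0 -linearBr /= => /eqP/mul_nzd[] /eqP.
    by rewrite vecof_eq0 // (negbTE u0).
  by rewrite -linearB vecof_eq0 // subr_eq0 => /eqP.
have := zE u v (g (co d)); rewrite (can_inj coK (Kg (co d))) => <-.
by rewrite uv0 -(scale0r 0) dotZ mul0r.
Qed.

End SymplecticArray.

Theorem theorem2 (q : nat) (q_cases : q \in [:: 3; 5; 7; 9]%N)
    (F : finFieldType) (cardF : #|F| = q)
    (S : vectType F) (dimS : \dim {:S} = 4%N)
    (mul : {bilinear S -> S -> S})
    (mul_nzd : no_zero_divisors mul)
    (mul_nonassoc : ~ associative mul)
    (mul_symplectic : symplectic mul) :
  exists (L : splittingFieldType F) (sigma : gal_of {:L}) (eta : L),
    [/\ \dim {:L} = 2%N,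
        sigma \in ('Gal({:L} / 1))%g,
        ~ (exists z : L, eta = z ^+ 2) &
        knuth_equivalent mul (dickson_mul sigma eta)].
Proof.
have [psi psiP dF] := digit_models q_cases cardF.
have dok := digits_for_ok q_cases.
have lam_ns := digit_lam_nonsquare dok psiP dF.
have two_neq0 : 2 != 0 :> F := digit_two_neq0 dok psiP.
have [L [sigma [i [dimL galS i2 conj_i span_i]]]] := quadratic_extension lam_ns.
have facts := field_search_facts q_cases psiP dF conj_i i2 span_i.
have e_basis := vbasisP {:S}; set e := vbasis _ in e_basis.
have [N Nu cP] := symplectic_array e_basis mul_nzd mul_symplectic.
suff [tau [eta [galT eta_ns iso]]] : exists (tau : gal_of {:L}) (eta : L),
    [/\ tau \in ('Gal({:L} / 1))%g, ~ (exists z : L, eta = z ^+ 2) &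
        isotopic (mul_of_array (permute_array (tperm 1 2) (cubical_array mul e)))
          (dickson_mul tau eta)].
  by exists L, tau, eta; split=> //; exists e, (tperm 1 2).
(* The dimension occurs in the types of the array and of N, so both are generalized before it is
   replaced by 4. *)
move: (cubical_array mul e) N Nu cP; rewrite dimS => T N Nu [cC c_linear c_nzd].
exact: dickson_isotopic galS conj_i i2 span_i lam_ns two_neq0 facts Nu cC c_linear c_nzd.
Qed.
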